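(* Let $\omega$ be a clustering state. There exists a bijection $\mathfrak D^*:\mathcal Q^*_\omega\to\mathcal H^*_\omega$ such that for every $Q^*_\omega\in\mathcal Q^*_\omega$ and every $A\in\mathcal O$, $$Q^*_\omega(A)=\langle\mathfrak D^*(Q^*_\omega),A\rangle^*_\omega.$$ In particular, every $Q^*_\omega$ extends to a continuous linear functional on $\mathcal H^*_\omega$.
   Context: Setting: Fix $D\ge1$, $\mathbb Z^D$ with $\mathrm{dist}(x,y)=\sum_i|x_i-y_i|$, $\mathtt B(n)=\{x:\mathrm{dist}(x,0)\le n\}$. $\mathcal O$ is a complex normed space with distinguished $\mathbf 1$ of norm 1, finite-dimensional subspaces $\mathcal O_X$ ($X$ finite) with $\mathcal O_\emptyset=\mathbb C\mathbf 1$, $X\subset Y\Rightarrow\mathcal O_X\subset\mathcal O_Y$, $\mathcal O_X\cap\mathcal O_Y=\mathcal O_{X\cap Y}$, $\mathcal O=\bigcup_X\mathcal O_X$; $\mathrm{supp}(A)$ smallest $X$ with $A\in\mathcal O_X$, $|A|=|\mathrm{supp}A|$, $\mathrm{dist}(A,B)$ distance of supports ($\mathrm{dist}(A,\mathbf 1)=\infty$). Completion $\mathcal A$ is a unital $C^*$-algebra, $\mathcal O_X$ are $C^*$-subalgebras, disjointly supported elements commute with union support of the product; translations $\iota_x$ are $*$-automorphisms, $\iota_x\iota_y=\iota_{x+y}$, $\mathrm{supp}(\iota_xA)=\mathrm{supp}(A)+x$. Clustering state: translation-invariant state $\omega$ with $\nu:\mathbb N\to\mathbb R^+$, $f:\mathbb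 Z\to\mathbb R^+$, $p>D$, $f(d)\le d^{-p}$ ($d>0$), $|\omega(AB)-\omega(A)\omega(B)|\le\nu(\ell)\|A\|\|B\|f(\mathrm{dist}(A,B))$ for $|A|,|B|<\ell$. Forms: $\langle A,B\rangle_\omega:=\sum_x(\omega(\iota_x(A)^*B)-\omega(A^* )\omega(B))$ and $\langle A,B\rangle^*_\omega:=\langle B^*,A^*\rangle_\omega$; both positive semi-definite. $\mathcal H^*_\omega$ is the Cauchy completion of $\mathcal O$ modulo the null space of $\langle\cdot,\cdot\rangle^*_\omega$ (elements of $\mathcal O$ identified with classes). Pseudolocal sequence $Q=(Q_n)$, $Q_n\in\mathcal O_{\mathtt B(n)}$: $Q'_n:=Q_n-\omega(Q_n)\mathbf 1$ satisfies (I) $\omega(Q_n'^*Q'_n)\le\gamma n^D$ for some $\gamma>0$, all $n>0$; (II) $Q_\omega(A):=\lim_n\omega(Q_n'^*A)$ exists for all $A\in\mathcal O$; (III) for some $0<k<1$, $\lim_n\max_{x,y\in\mathtt B(kn)}|\omega(Q_n'^*\iota_xA)-\omega(Q_n'^*\iota_yA)|=0$ for all $A$. The right pseudolocal charge of $Q$ is the functional $Q^*_\omega$ on $\mathcal O$ defined by $Q^*_\omega(A^* ):=\overline{Q_\omega(A)}$, i.e. $Q^*_\omega(B)=\lim_n(\omega(BQ_n)-\omega(B)\omega(Q_n))$; $\mathcal Q^*_\omega$ is the set of right pseudolocal charges. *)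

(* Defs.v *)
From HB Require Import structures.
From Stdlib Require Import ClassicalEpsilon.
From mathcomp Require Import all_boot all_order all_algebra.
From mathcomp Require Import all_classical all_reals all_analysis.
From mathcomp Require Import complex.
From mathcomp Require Import finmap.
Import Order.TTheory GRing.Theory Num.Theory.
Import numFieldNormedType.Exports.

Set Implicit Arguments.
Unset Strict Implicit.
Unset Printing Implicit Defensive.

Local Open Scope classical_set_scope.
Local Open Scope complex_scope.
Local Open Scope ring_scope.

(* The complex numbers R[i] (R : realType) as a normed space, so that
   limits of complex sequences make sense. *)
#[export] HB.instance Definition _ (R : rcfType) :=
  GRing.ComAlgebra.copy R[i] (R[i])^o.
#[export] HB.instance Definition _ (R : rcfType) := Vector.copy R[i] (R[i])^o.
#[export] HB.instance Definition _ (R : rcfType) :=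
  NormedModule.copy R[i] (R[i])^o.

Definition Zd (D : nat) := {ffun 'I_D -> int}.

Definition ldist (D : nat) (x y : Zd D) : nat := \sum_(i < D) `|x i - y i|%N.

Definition box (D n : nat) : seq (Zd D) :=
  [seq [ffun i => (k i)%:Z - n%:Z] | k : {ffun 'I_D -> 'I_(2 * n + 1)}].

Definition ball (D n : nat) : {fset Zd D} :=
  [fset x in box D n | (ldist x 0%R <= n)%N]%fset.

Definition fshift (D : nat) (X : {fset Zd D}) (x : Zd D) : {fset Zd D} :=
  [fset (y + x)%R | y in X]%fset.

(* distance between two finite sets (meaningful for nonempty sets) *)
Definition fdist (D : nat) (X Y : {fset Zd D}) : nat :=
  xget 0%N (fun d => (exists x y, x \in X /\ y \in Y /\ ldist x y = d) /\
                     (forall x y, x \in X -> y \in Y -> (d <= ldist x y)%N)).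

(* sum over Z^D of a (absolutely summable) family, as the limit of the
   partial sums over the balls B(n) *)
Definition lsum (R : realType) (D : nat) (F : Zd D -> R[i]) : R[i] :=
  lim ((fun n => \sum_(x <- ball D n) F x) @ \oo).

Section QuasiLocal.
Variables (R : realType) (D : nat) (O : algType R[i]).
Variables (star : O -> O) (nrm : O -> R) (OX : {fset Zd D} -> set O)
          (iota : Zd D -> O -> O).

Definition supp (a : O) : {fset Zd D} :=
  xget fset0 (fun X => OX X a /\ forall Y, OX Y a -> (X `<=` Y)%fset).

(* The quasi-local structure: O a complex normed *-algebra whose norm is a
   C*-norm (so that its completion is a unital C*-algebra), with local
   finite-dimensional *-subalgebras O_X and translations. *)
Record quasi_local : Prop := {
  star_add : forall a b, star (a + b) = star a + star b;
  star_scale : forall (c : R[i]) a, star (c *: a) = Num.conj c *: star a;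
  star_mul : forall a b, star (a * b) = star b * star a;
  star_invol : forall a, star (star a) = a;
  nrm_eq0 : forall a, nrm a = 0 -> a = 0;
  nrm_add : forall a b, nrm (a + b) <= nrm a + nrm b;
  nrm_scale : forall (c : R[i]) a, (nrm (c *: a))%:C = `|c| * (nrm a)%:C;
  nrm_mul : forall a b, nrm (a * b) <= nrm a * nrm b;
  nrm_Cstar : forall a, nrm (star a * a) = nrm a ^+ 2;
  nrm_one : nrm 1 = 1;
  OX_one : forall X, OX X 1;
  OX_add : forall X a b, OX X a -> OX X b -> OX X (a + b);
  OX_scale : forall X (c : R[i]) a, OX X a -> OX X (c *: a);
  OX_mul : forall X a b, OX X a -> OX X b -> OX X (a * b);
  OX_star : forall X a, OX X a -> OX X (star a);
  OX_findim : forall X, exists s : seq O, forall a, OX X a ->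
      exists c : 'I_(size s) -> R[i], a = \sum_(i < size s) c i *: s`_i;
  OX_empty : forall a, OX fset0 a <-> exists c : R[i], a = c%:A;
  OX_mono : forall X Y, (X `<=` Y)%fset -> forall a, OX X a -> OX Y a;
  OX_cap : forall X Y a, (OX X a /\ OX Y a) <-> OX (X `&` Y)%fset a;
  OX_cover : forall a, exists X, OX X a;
  OX_commute : forall X Y a b, [disjoint X & Y]%fset -> OX X a -> OX Y b ->
      a * b = b * a /\ OX (X `|` Y)%fset (a * b);
  iota_add : forall x a b, iota x (a + b) = iota x a + iota x b;
  iota_scale : forall x (c : R[i]) a, iota x (c *: a) = c *: iota x a;
  iota_mul : forall x a b, iota x (a * b) = iota x a * iota x b;
  iota_one : forall x, iota x 1 = 1;
  iota_star : forall x a, iota x (star a) = star (iota x a);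
  iota_bij : forall x, bijective (iota x);
  iota_nrm : forall x a, nrm (iota x a) = nrm a;
  iota_comp : forall x y a, iota x (iota y a) = iota (x + y) a;
  iota_supp : forall x a, supp (iota x a) = fshift (supp a) x
}.

Variable omega : O -> R[i].

Record clustering_state (nu : nat -> R) (f : nat -> R) (p : R) : Prop := {
  omega_add : forall a b, omega (a + b) = omega a + omega b;
  omega_scale : forall (c : R[i]) a, omega (c *: a) = c * omega a;
  omega_pos : forall a, 0 <= omega (star a * a);
  omega_one : omega 1 = 1;
  omega_bounded : forall a, `|omega a| <= (nrm a)%:C;
  omega_transl : forall x a, omega (iota x a) = omega a;
  nu_ge0 : forall l, 0 <= nu l;
  f_ge0 : forall d, 0 <= f d;
  p_gtD : D%:R < p;
  f_decay : forall d, (0 < d)%N -> f d <= d%:R `^ (- p);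
  clustering : forall (l : nat) a b,
      (#|` supp a| < l)%N -> (#|` supp b| < l)%N ->
      supp a != fset0 -> supp b != fset0 ->
      `|omega (a * b) - omega a * omega b|
        <= (nu l * nrm a * nrm b * f (fdist (supp a) (supp b)))%:C
}.

Definition form (a b : O) : R[i] :=
  lsum (fun x => omega (star (iota x a) * b) - omega (star a) * omega b).
Definition formS (a b : O) : R[i] := form (star b) (star a).

Definition seminormS (a : O) : R := Num.sqrt (complex.Re (formS a a)).

Definition cauchyS (u : nat -> O) : Prop :=
  forall e : R, 0 < e -> exists N, forall m n, (N <= m)%N -> (N <= n)%N ->
    seminormS (u m - u n) < e.

Definition equivS (u v : nat -> O) : Prop :=
  forall e : R, 0 < e -> exists N, forall n, (N <= n)%N ->
    seminormS (u n - v n) < e.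

Definition is_class (E : set (nat -> O)) : Prop :=
  exists u, cauchyS u /\ E = [set v | cauchyS v /\ equivS u v].

Definition Hstar : Type := {E : set (nat -> O) | is_class E}.

Definition rep (h : Hstar) : nat -> O :=
  epsilon (inhabits (fun _ : nat => 0)) (proj1_sig h).

Definition formH (h : Hstar) (a : O) : R[i] :=
  lim ((fun n => formS (rep h n) a) @ \oo).

Definition Qp (Q : nat -> O) (n : nat) : O := Q n - omega (Q n) *: 1.

Record pseudolocal (Q : nat -> O) : Prop := {
  Q_local : forall n, OX (ball D n) (Q n);
  Q_I : exists gamma : R, 0 < gamma /\ forall n, (0 < n)%N ->
      omega (star (Qp Q n) * Qp Q n) <= (gamma * n%:R ^+ D)%:C;
  Q_II : forall a, cvg ((fun n => omega (star (Qp Q n) * a)) @ \oo);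
  Q_III : exists k : R, 0 < k < 1 /\ forall a (e : R), 0 < e ->
      exists N, forall n, (N <= n)%N -> forall x y : Zd D,
        (ldist x 0)%:R <= k * n%:R -> (ldist y 0)%:R <= k * n%:R ->
        `|omega (star (Qp Q n) * iota x a) - omega (star (Qp Q n) * iota y a)|
          < e%:C
}.

Definition Qomega (Q : nat -> O) (a : O) : R[i] :=
  lim ((fun n => omega (star (Qp Q n) * a)) @ \oo).

Definition Qstar_set : set (O -> R[i]) :=
  [set F | exists Q, pseudolocal Q /\
           forall a, F (star a) = Num.conj (Qomega Q a)].

End QuasiLocal.

(* Main.v *)
(* A right pseudolocal charge F(a) = lim w(a Q'_n) is asymptotically invariant
   under translations, so F(a) may be computed on the spatial average of a over
   a cube of side proportional to n.  Cauchy-Schwarz for the state w, condition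
   (I), and the fact that the variance of that average, times the volume of the
   cube, tends to <a,a>* give |F(a)| <= C <a,a>*^(1/2).  Riesz's theorem then
   represents F by a Cauchy sequence.  Conversely, for a single u in O the
   adjoints of the sums of the translates of u over cubes form a pseudolocal
   sequence with charge <u, .>*; the cluster estimate is uniform over observables
   of bounded support and norm, so a Cauchy sequence u_j is handled by a diagonal
   sequence in which j grows slowly enough with n.  Everything rests on the
   summability over Z^D of the correlations w(iota_x(a) b) - w(a) w(b), which
   clustering with p > D provides. *)
Require Import Defs.
From HB Require Import structures.
From Stdlib Require Import ClassicalEpsilon.
From mathcomp Require Import all_boot all_order all_algebra.
From mathcomp Require Import all_classical all_reals all_analysis.
From mathcomp Require Import complex.
From mathcomp Require Import finmap.
From mathcomp Require Import zify ring lra.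
Import Order.TTheory GRing.Theory Num.Theory.
Import numFieldNormedType.Exports.
Local Open Scope classical_set_scope.
Local Open Scope ring_scope.

Set Implicit Arguments.
Unset Strict Implicit.
Unset Printing Implicit Defensive.

(** * Complex sequences and positive semidefinite forms *)

Section ComplexModulus.
Context {R : realType}.
Implicit Types (z w : R[i]) (u v : nat -> R[i]).

(** The norm of [R[i]] takes its values in [R[i]]; this real-valued version lets estimates be
    carried out in the ordered field [R]. *)
Definition cabs z : R := complex.Re `|z|.

Lemma cabsE z : `|z| = (cabs z)%:C%C.
Proof. by rewrite /cabs RRe_real. Qed.

Lemma cabs_ge0 z : 0 <= cabs z.
Proof. by rewrite -lecR -cabsE normr_ge0. Qed.

Lemma cabs0 : cabs 0 = 0.
Proof. by rewrite /cabs normr0. Qed.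

Lemma cabsD z w : cabs (z + w) <= cabs z + cabs w.
Proof. by rewrite -lecR rmorphD /= -!cabsE ler_normD. Qed.

Lemma cabsN z : cabs (- z) = cabs z.
Proof. by rewrite /cabs normrN. Qed.

Lemma cabs_distC z w : cabs (z - w) = cabs (w - z).
Proof. by rewrite /cabs distrC. Qed.

Lemma cabsB z w : cabs (z - w) <= cabs z + cabs w.
Proof. by rewrite -(cabsN w) cabsD. Qed.

Lemma cabsM z w : cabs (z * w) = cabs z * cabs w.
Proof. by apply: complexI; rewrite rmorphM /= -!cabsE normrM. Qed.

Lemma cabsJ z : cabs (Num.conj z) = cabs z.
Proof. by rewrite /cabs norm_conjC. Qed.

Lemma cabsR (x : R) : 0 <= x -> cabs x%:C%C = x.
Proof. by move=> x0; apply: complexI; rewrite -cabsE ger0_norm // lecR. Qed.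

Lemma cabs_real (x : R) : cabs x%:C%C = `|x|.
Proof.
by apply: complexI; rewrite -cabsE normc_def /= expr0n addr0 sqrtr_sqr.
Qed.

Lemma cabsi : cabs 'i%C = 1.
Proof. by rewrite /cabs normc_def /= expr0n expr1n add0r sqrtr1. Qed.

Lemma cabs_sqr z : (cabs z ^+ 2)%:C%C = z * Num.conj z.
Proof. by rewrite rmorphXn /= -cabsE normCK. Qed.

Lemma Re_le_cabs z : complex.Re z <= cabs z.
Proof.
have := normc_ge_Re z; rewrite cabsE lecR; apply: le_trans; exact: ler_norm.
Qed.

Lemma cabs_sum (I : Type) (s : seq I) (F : I -> R[i]) :
  cabs (\sum_(x <- s) F x) <= \sum_(x <- s) cabs (F x).
Proof.
elim: s => [|x s IH]; first by rewrite !big_nil cabs0.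
by rewrite !big_cons (le_trans (cabsD _ _)) // lerD2l.
Qed.

Lemma ger0_Re z : 0 <= z -> z = (complex.Re z)%:C%C.
Proof. by move=> z0; rewrite RRe_real // realE z0. Qed.

Lemma Re_ge0 z : 0 <= z -> 0 <= complex.Re z.
Proof. by rewrite lecE => /andP[]. Qed.

Lemma cabs_le_ReIm z : cabs z <= `|complex.Re z| + `|complex.Im z|.
Proof.
rewrite {1}(complexE z) (le_trans (cabsD _ _)) //.
by rewrite cabsM cabsi mul1r !cabs_real.
Qed.

Lemma cabs_Re z : `|complex.Re z| <= cabs z.
Proof. by have := normc_ge_Re z; rewrite cabsE lecR. Qed.

Lemma cabs_Im z : `|complex.Im z| <= cabs z.
Proof.
rewrite -(mul1r (cabs z)) -cabsi mulrC -cabsM -normrN -ReiNIm; exact: cabs_Re.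
Qed.

(** A positive element of [R[i]] is real, so the radii defining the topology may be taken in [R]. *)
Lemma cvgC_iff u l : u @ \oo --> l <->
  forall e : R, 0 < e -> exists N, forall n, (N <= n)%N -> cabs (u n - l) < e.
Proof.
split=> [/cvgrPdist_lt H e e0|H].
  have /H[N _ HN] : 0 < e%:C%C by rewrite ltcR.
  by exists N => n /HN /=; rewrite cabsE ltcR cabs_distC.
apply/cvgrPdist_lt => e e0.
have e1 : e = (complex.Re e)%:C%C by rewrite RRe_real // realE ltW.
have /H[N HN] : 0 < complex.Re e by rewrite -ltcR -e1.
by exists N => // n /HN /=; rewrite e1 cabsE ltcR cabs_distC.
Qed.

Lemma limC u l : u @ \oo --> l -> lim (u @ \oo) = l.
Proof. by move=> h; apply: cvg_lim h; exact: norm_hausdorff. Qed.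

Lemma cvgC_unique u (l l' : R[i]) : u @ \oo --> l -> u @ \oo --> l' -> l = l'.
Proof. by move=> /limC <- /limC. Qed.

Lemma cvgCD u v (l l' : R[i]) : u @ \oo --> l -> v @ \oo --> l' ->
  (fun n => u n + v n) @ \oo --> l + l'.
Proof. exact: cvgD. Qed.

Lemma cvgCM u l z : u @ \oo --> l -> (fun n => z * u n) @ \oo --> z * l.
Proof.
move=> /cvgC_iff H; apply/cvgC_iff => e e0.
have z1 : 0 < cabs z + 1 by rewrite ltr_wpDl ?cabs_ge0.
have /H[N HN] : 0 < e / (cabs z + 1) by rewrite divr_gt0.
exists N => n /HN; rewrite ltr_pdivlMr // => h.
rewrite -mulrBr cabsM mulrC; apply: le_lt_trans h.
by rewrite ler_wpM2l ?cabs_ge0 // lerDl.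
Qed.

Lemma cvgCJ u l : u @ \oo --> l ->
  (fun n => Num.conj (u n)) @ \oo --> Num.conj l.
Proof.
move=> /cvgC_iff H; apply/cvgC_iff => e /H[N HN]; exists N => n /HN.
by rewrite -rmorphB cabsJ.
Qed.

(** Being nonnegative in [R[i]] includes having zero imaginary part, so [Im l] and the sign of
    [Re l] are treated in turn. *)
Lemma limC_ge0 u l : u @ \oo --> l -> (forall n, 0 <= u n) -> 0 <= l.
Proof.
move=> /cvgC_iff H u0; rewrite lecE; apply/andP; split.
  rewrite -normr_le0; apply/ler_addgt0Pl => e /H[N /(_ _ (leqnn N)) h].
  rewrite addr0; apply: ltW; apply: le_lt_trans h.
  rewrite -cabsN (le_trans _ (cabs_Im _)) //.
  have := u0 N; rewrite lecE => /andP[/eqP h _].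
  by rewrite raddfN raddfB /= h sub0r opprK.
rewrite -[leRHS]opprK oppr_ge0; apply/ler_addgt0Pl => e /H[N].
move=> /(_ _ (leqnn N)) h; rewrite addr0; apply: ltW; apply: le_lt_trans h.
apply: le_trans (Re_le_cabs _); rewrite raddfB /= lerDr; exact: Re_ge0.
Qed.

Lemma cvgC_cabs_le u l (B : R) : u @ \oo --> l ->
  (exists N, forall n, (N <= n)%N -> cabs (u n) <= B) -> cabs l <= B.
Proof.
move=> /cvgC_iff H [N1 HB]; apply/ler_addgt0Pl => e /H[N2 HN].
rewrite -(subrK (u (maxn N1 N2)) l) addrC [leRHS]addrC.
rewrite (le_trans (cabsD _ _)) // lerD //; first by rewrite HB ?leq_maxl.
by rewrite cabs_distC ltW // HN ?leq_maxr.
Qed.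

Lemma cauchyC_cvg u :
  (forall e : R, 0 < e -> exists N, forall m n, (N <= m)%N -> (N <= n)%N ->
     cabs (u m - u n) < e) -> cvg (u @ \oo).
Proof.
move=> H.
have real_case (v : nat -> R) :
    (forall m n, `|v m - v n| <= cabs (u m - u n)) ->
    cvg (v @ \oo).
  move=> Hv; apply/cauchy_cvgP/cauchy_exP => e e0.
  have [N HN] := H _ e0; exists (v N); exists N => // n /= Nn.
  by rewrite /ball_ /=; apply: le_lt_trans (Hv _ _) _; exact: HN.
have /real_case/cvgrPdist_lt hr : forall m n,
    `|complex.Re (u m) - complex.Re (u n)| <= cabs (u m - u n).
  by move=> m n; rewrite -raddfB cabs_Re.
have /real_case/cvgrPdist_lt hi : forall m n,
    `|complex.Im (u m) - complex.Im (u n)| <= cabs (u m - u n).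
  by move=> m n; rewrite -raddfB cabs_Im.
set a := lim _ in hr; set b := lim _ in hi.
apply: (cvgP (Complex a b)); apply/cvgC_iff => e e0.
have e2 : 0 < e / 2 by rewrite divr_gt0.
have [N1 _ h1] := hr _ e2; have [N2 _ h2] := hi _ e2.
exists (maxn N1 N2) => n; rewrite geq_max => /andP[/h1 /= r1 /h2 /= r2].
apply: le_lt_trans (cabs_le_ReIm _) _.
rewrite !raddfB /= distrC [X in _ + X]distrC.
by rewrite (splitr e) ltrD.
Qed.

End ComplexModulus.

(** * Positive semidefinite forms: Cauchy-Schwarz and Riesz representation *)

Lemma quadratic_ge0 (R : realType) (A w Q : R) : 0 <= Q ->
  (forall t, 0 <= A + 2 * t * w + t ^+ 2 * Q) -> w ^+ 2 <= A * Q.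
Proof.
move=> Q0 H; have [Qe|Qn] := eqVneq Q 0.
  have [->|wn] := eqVneq w 0; first by rewrite Qe expr0n mulr0.
  (* For [Q = 0] the polynomial is affine in [t], and this [t] gives it the value -1. Otherwise the
     minimizer [- w / Q] is used. *)
  have := H (- (A + 1) / (2 * w)); rewrite Qe mulr0 addr0.
  have -> : 2 * (- (A + 1) / (2 * w)) * w = - (A + 1) by field.
  lra.
have := H (- w / Q).
have -> : A + 2 * (- w / Q) * w + (- w / Q) ^+ 2 * Q = (A * Q - w ^+ 2) / Q.
  by field.
by rewrite pmulr_lge0 ?invr_gt0 ?lt_def ?Qn // subr_ge0.
Qed.

Record psd_form (R : realType) (V : lmodType R[i]) (B : V -> V -> R[i]) :
    Prop := {
  psdDl : forall a b c, B (a + b) c = B a c + B b c;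
  psdDr : forall a b c, B a (b + c) = B a b + B a c;
  psdZl : forall k a b, B (k *: a) b = Num.conj k * B a b;
  psdZr : forall k a b, B a (k *: b) = k * B a b;
  psd_ge0 : forall a, 0 <= B a a
}.

(** For [B] the form [formS], this and [fcauchy] are convertible with [seminormS] and [cauchyS], so
    the abstract results apply to the completion directly. *)
Definition fnorm (R : realType) (V : lmodType R[i]) (B : V -> V -> R[i])
    (a : V) : R :=
  Num.sqrt (complex.Re (B a a)).

Definition fcauchy (R : realType) (V : lmodType R[i]) (B : V -> V -> R[i])
    (u : nat -> V) :=
  forall e : R, 0 < e -> exists N, forall m n, (N <= m)%N -> (N <= n)%N ->
    fnorm B (u m - u n) < e.

Section PsdForm.
Context {R : realType} {V : lmodType R[i]} {B : V -> V -> R[i]}.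
Hypothesis HB : psd_form B.

Notation sn := (fnorm B).
Notation fcauchy := (fcauchy B).

Lemma psdNl a b : B (- a) b = - B a b.
Proof. by rewrite -scaleN1r (psdZl HB) rmorphN1 mulN1r. Qed.

Lemma psdNr a b : B a (- b) = - B a b.
Proof. by rewrite -scaleN1r (psdZr HB) mulN1r. Qed.

Lemma psdBl a b c : B (a - b) c = B a c - B b c.
Proof. by rewrite (psdDl HB) psdNl. Qed.

(** Polarization: [B c c] is real for [c = a + b] and for [c = a + 'i *: b], which fixes the
    imaginary and the real part of [B b a]. *)
Lemma psd_herm a b : B b a = Num.conj (B a b).
Proof.
have Im0 c : complex.Im (B c c) = 0.
  by have := psd_ge0 HB c; rewrite lecE => /andP[/eqP].
have h1 := Im0 (a + b); have h2 := Im0 (a + 'i%C *: b).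
have ha := Im0 a; have hb := Im0 b.
move: h1 h2; rewrite !(psdDl HB) !(psdDr HB) !(psdZl HB) !(psdZr HB).
case: (B a b) (B b a) (B a a) (B b b) ha hb
  => [x1 y1] [x2 y2] [x3 y3] [x4 y4] /= -> ->.
rewrite !(mulr0, mul0r, mul1r, mulN1r, mulrN, mulNr, oppr0, subr0, addr0, add0r).
move=> h1 h2; apply/eqP; rewrite eq_complex /=.
by apply/andP; split; apply/eqP; lra.
Qed.

Lemma fnorm_ge0 a : 0 <= sn a. Proof. exact: sqrtr_ge0. Qed.

Lemma fnorm_sqr a : B a a = (sn a ^+ 2)%:C%C.
Proof. by rewrite sqr_sqrtr ?Re_ge0 ?(psd_ge0 HB) // -ger0_Re // (psd_ge0 HB). Qed.

Lemma fnormZ k a : sn (k *: a) = cabs k * sn a.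
Proof.
have h : sn (k *: a) ^+ 2 = (cabs k * sn a) ^+ 2.
  apply: complexI; rewrite -fnorm_sqr exprMn rmorphM /= -fnorm_sqr cabs_sqr.
  by rewrite (psdZl HB) (psdZr HB) !mulrA [k * _]mulrC.
by apply/eqP; rewrite -(eqrXn2 (n := 2)) ?mulr_ge0 ?cabs_ge0 ?fnorm_ge0 // h.
Qed.

Lemma fnormN a : sn (- a) = sn a.
Proof. by rewrite /fnorm psdNl psdNr opprK. Qed.

Lemma fnorm_distC a b : sn (a - b) = sn (b - a).
Proof. by rewrite -fnormN opprB. Qed.

Lemma fnormD_sqr a b :
  sn (a + b) ^+ 2 = sn a ^+ 2 + 2 * complex.Re (B a b) + sn b ^+ 2.
Proof.
have E c : sn c ^+ 2 = complex.Re (B c c).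
  by rewrite sqr_sqrtr ?Re_ge0 ?(psd_ge0 HB).
rewrite !E (psdDl HB) !(psdDr HB) (psd_herm a b) !raddfD /=.
by case: (B a b) => x y /=; ring.
Qed.

Lemma psd_CS_sqr a b : cabs (B a b) ^+ 2 <= sn a ^+ 2 * sn b ^+ 2.
Proof.
set w := cabs (B a b) ^+ 2.
have [w0|wn] := eqVneq w 0; first by rewrite w0 mulr_ge0 ?sqr_ge0.
have wp : 0 < w by rewrite lt_def wn sqr_ge0.
have : w ^+ 2 <= sn a ^+ 2 * (w * sn b ^+ 2).
  apply: quadratic_ge0; first by rewrite mulr_ge0 ?sqr_ge0.
  (* This direction makes the cross term [B a (k *: b)] equal to the real number [t * w]; the
     surplus factor [w] of the discriminant bound is cancelled at the end. *)
  move=> t; set k := t%:C%C * Num.conj (B a b).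
  have := sqr_ge0 (sn (a + k *: b)); rewrite fnormD_sqr.
  have -> : B a (k *: b) = (t * w)%:C%C.
    by rewrite (psdZr HB) -mulrA [_^* * _]mulrC -cabs_sqr [RHS]rmorphM.
  by rewrite fnormZ cabsM cabsJ cabs_real !exprMn real_normK ?num_real // !mulrA.
by clearbody w; rewrite expr2 [leRHS]mulrCA ler_pM2l.
Qed.

Lemma psd_CS a b : cabs (B a b) <= sn a * sn b.
Proof.
by rewrite -(ler_pXn2r (n := 2)) ?nnegrE ?cabs_ge0 ?mulr_ge0 ?fnorm_ge0 //
  exprMn psd_CS_sqr.
Qed.

Lemma fnormD a b : sn (a + b) <= sn a + sn b.
Proof.
rewrite -(ler_pXn2r (n := 2)) ?nnegrE ?addr_ge0 ?fnorm_ge0 // fnormD_sqr.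
rewrite sqrrD lerD2r lerD2l -[leRHS]mulr_natl ler_pM2l //.
exact: le_trans (Re_le_cabs _) (psd_CS _ _).
Qed.

Lemma fnormB a b : sn (a - b) <= sn a + sn b.
Proof. by rewrite -(fnormN b) fnormD. Qed.

Lemma fcauchy_bounded u : fcauchy u ->
  exists M, 0 < M /\ exists N, forall n, (N <= n)%N -> sn (u n) <= M.
Proof.
move=> /(_ _ ltr01)[N HN]; exists (sn (u N) + 1); split.
  by rewrite ltr_wpDl ?fnorm_ge0.
exists N => n Nn; rewrite -(subrK (u N) (u n)) addrC (le_trans (fnormD _ _)) //.
by rewrite lerD2l ltW // HN.
Qed.

Lemma fcauchy_cvg u a : fcauchy u -> cvg ((fun n => B (u n) a) @ \oo).
Proof.
move=> Hu; apply: cauchyC_cvg => e e0.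
have s1 : 0 < sn a + 1 by rewrite ltr_wpDl ?fnorm_ge0.
have /Hu[N HN] : 0 < e / (sn a + 1) by rewrite divr_gt0.
exists N => m n hm hn; rewrite -psdBl.
apply: le_lt_trans (psd_CS _ _) _.
apply: (@le_lt_trans _ _ (sn (u m - u n) * (sn a + 1))).
  by rewrite ler_wpM2l ?fnorm_ge0 // lerDl.
by rewrite -ltr_pdivlMr // HN.
Qed.

Lemma fcauchyB u v : fcauchy u -> fcauchy v -> fcauchy (fun n => u n - v n).
Proof.
move=> Hu Hv e e0; have e2 : 0 < e / 2 by rewrite divr_gt0.
have [N1 h1] := Hu _ e2; have [N2 h2] := Hv _ e2.
exists (maxn N1 N2) => m n; rewrite !geq_max => /andP[a1 a2] /andP[b1 b2].
have -> : u m - v m - (u n - v n) = (u m - u n) - (v m - v n).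
  by rewrite !opprB addrACA [- v m + _]addrC addrACA.
apply: le_lt_trans (fnormB _ _) _.
by rewrite (splitr e) ltrD // ?h1 ?h2.
Qed.

(** Split [B (w n) (w n)] as [B (w n) (w n - w N1) + B (w n) (w N1)]: boundedness and the Cauchy
    property control the first term, weak convergence the second. Hence a class is determined by its
    functional. *)
Lemma fcauchy_weak0 w : fcauchy w ->
  (forall a, (fun n => B (w n) a) @ \oo --> (0 : R[i])) ->
  forall e : R, 0 < e -> exists N, forall n, (N <= n)%N -> sn (w n) < e.
Proof.
move=> Hw H e e0.
have [M [M0 [N0 HM]]] := fcauchy_bounded Hw.
have e2 : 0 < e ^+ 2 / 2 by rewrite divr_gt0 // exprn_gt0.
have /Hw[N1 h1] : 0 < e ^+ 2 / 2 / M by rewrite divr_gt0.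
have /cvgC_iff/(_ _ e2)[N2 h2] := H (w N1).
exists (maxn N0 (maxn N1 N2)) => n; rewrite !geq_max => /and3P[n0 n1 n2].
rewrite -(ltr_pXn2r (n := 2)) ?nnegrE ?fnorm_ge0 ?(ltW e0) //.
have -> : sn (w n) ^+ 2 = complex.Re (B (w n) (w n)).
  by rewrite sqr_sqrtr ?Re_ge0 ?(psd_ge0 HB).
apply: le_lt_trans (Re_le_cabs _) _.
rewrite -{2}(subrK (w N1) (w n)) (psdDr HB) (le_lt_trans (cabsD _ _)) //.
rewrite (splitr (e ^+ 2)) ler_ltD //; last by have := h2 n n2; rewrite subr0.
apply: le_trans (psd_CS _ _) _.
have h3 := ltW (h1 n N1 n1 (leqnn _)); rewrite ler_pdivlMr // mulrC in h3.
by apply: le_trans h3; rewrite ler_wpM2r ?fnorm_ge0 // HM.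
Qed.

(* The sequence minimizes |v|^2 - 2 Re F(v): it is Cauchy by the parallelogram
   law, and first variation at u_n gives |Re(B(u_n,a) - F a)|^2 <= |a|^2/(n+1). *)
Lemma riesz_seq (F : V -> R[i]) (C : R) :
  (forall a b, F (a + b) = F a + F b) -> (forall k a, F (k *: a) = k * F a) ->
  0 <= C -> (forall a, cabs (F a) <= C * sn a) ->
  exists u, fcauchy u /\ forall a, (fun n => B (u n) a) @ \oo --> F a.
Proof.
move=> FD FZ C0 FC.
pose J v := sn v ^+ 2 - 2 * complex.Re (F v).
have Jlb v : - C ^+ 2 <= J v.
  have h1 := Re_le_cabs (F v); have h2 := FC v; have h3 := sqr_ge0 (sn v - C).
  rewrite /J; nra.
pose S := [set J v | v in setT].
have S0 : S !=set0 by exists (J 0); exists 0.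
have Slb : has_lbound S by exists (- C ^+ 2) => _ [v _ <-].
pose m := inf S.
have mJ v : m <= J v by apply: ge_inf => //; exists v.
have /choice[u Hu] : forall n : nat, exists v, J v < m + n.+1%:R^-1.
  move=> n; have n0 : 0 < n.+1%:R^-1 :> R by rewrite invr_gt0.
  have [_ [v _ <-] h] := inf_adherent n0 (conj S0 Slb).
  by exists v.
have eps (e : R) : 0 < e -> exists N, forall n, (N <= n)%N -> n.+1%:R^-1 < e.
  move=> e0; exists (Num.truncn e^-1) => n hn.
  rewrite -[e]invrK ltf_pV2 ?posrE ?invr_gt0 //.
  apply: lt_le_trans (truncnS_gt _) _; by rewrite ler_nat ltnS.
exists u; split.
  move=> e e0; have /eps[N HN] : 0 < e ^+ 2 / 4 by rewrite divr_gt0 // exprn_gt0.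
  exists N => i j hi hj.
  rewrite -(ltr_pXn2r (n := 2)) ?nnegrE ?fnorm_ge0 ?(ltW e0) //.
  have h1 := Hu i; have h2 := Hu j; have k1 := HN _ hi; have k2 := HN _ hj.
  (* [J] at the midpoint is at least [m], while [u i] and [u j] almost reach [m]; the parallelogram
     law then makes [u i - u j] small. *)
  have h3 := mJ (2^-1 *: (u i + u j)).
  have par : sn (u i - u j) ^+ 2 =
      2 * J (u i) + 2 * J (u j) - 4 * J (2^-1 *: (u i + u j)).
    rewrite /J fnormZ FZ FD exprMn.
    have -> : cabs 2^-1 = 2^-1 :> R.
      by rewrite -[RHS]cabsR ?invr_ge0 //; congr cabs; rewrite fmorphV rmorph_nat.
    have -> : complex.Re (2^-1 * (F (u i) + F (u j))) =
              2^-1 * (complex.Re (F (u i)) + complex.Re (F (u j))).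
      have -> : (2^-1 : R[i]) = (2^-1)%:C%C by rewrite fmorphV rmorph_nat.
      by case: (F (u i)) (F (u j)) => [? ?] [? ?] /=; rewrite mul0r subr0.
    rewrite fnormD_sqr fnormD_sqr fnormN psdNr raddfN /=; lra.
  rewrite par; move: h1 h2 h3 k1 k2.
  move: (J _) (J _) (J _) (e ^+ 2) (i.+1%:R^-1) (j.+1%:R^-1).
  by move=> *; lra.
have key n a : `|complex.Re (B (u n) a - F a)| ^+ 2 <= n.+1%:R^-1 * sn a ^+ 2.
  rewrite real_normK ?num_real //; apply: quadratic_ge0; first exact: sqr_ge0.
  move=> t; have h1 := Hu n; have := mJ (u n + t%:C%C *: a).
  rewrite /J fnormD_sqr fnormZ exprMn FD FZ (psdZr HB).
  rewrite cabs_real real_normK ?num_real //; move: h1; rewrite /J.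
  case: (B (u n) a) (F a) (F (u n)) => [x1 y1] [x2 y2] [x3 y3] /=.
  by rewrite !mul0r !subr0; move: n.+1%:R^-1 => d h1 h2; lra.
move=> a; apply/cvgC_iff => e e0.
have q0 : 0 < (e / 2) ^+ 2 / (sn a ^+ 2 + 1).
  by rewrite divr_gt0 ?exprn_gt0 ?divr_gt0 // ltr_wpDl ?sqr_ge0.
have [N HN] := eps _ q0; exists N => n hn.
have small b : sn b = sn a -> `|complex.Re (B (u n) b - F b)| < e / 2.
  move=> sb.
  rewrite -(ltr_pXn2r (n := 2)) ?nnegrE ?normr_ge0 ?divr_ge0 ?(ltW e0) //.
  apply: le_lt_trans (key n b) _; rewrite sb.
  apply: (@le_lt_trans _ _ (n.+1%:R^-1 * (sn a ^+ 2 + 1))).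
    by rewrite ler_wpM2l ?invr_ge0 // lerDl.
  by rewrite -ltr_pdivlMr ?HN // ltr_wpDl ?sqr_ge0.
apply: le_lt_trans (cabs_le_ReIm _) _; rewrite (splitr e) ltrD ?small //.
(* The real part at ['i *: a] is minus the imaginary part at [a]. *)
have := small ('i%C *: a); rewrite fnormZ cabsi mul1r => /(_ erefl).
by rewrite (psdZr HB) FZ -mulrBr mulrC ReiNIm normrN.
Qed.

End PsdForm.

(** * Sums over the lattice *)

Section Lattice.
Context {D : nat}.
Implicit Types x y z : Zd D.

Notation znorm x := (ldist x 0%R).

Lemma ldistC x y : ldist x y = ldist y x.
Proof. by apply: eq_bigr => i _; rewrite distnC. Qed.

Lemma ldistE x y : ldist x y = znorm (x - y).
Proof. by apply: eq_bigr => i _; rewrite !ffunE subr0. Qed.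

Lemma znormN x : znorm (- x) = znorm x.
Proof. by rewrite -sub0r -ldistE ldistC. Qed.

Lemma znormD x y : (znorm (x + y)%R <= znorm x + znorm y)%N.
Proof.
rewrite /ldist -big_split /=; apply: leq_sum => i _; rewrite !ffunE !subr0.
by move: (x i : int) (y i : int) => a b; lia.
Qed.

Lemma leq_coord_znorm x i : (`|x i| <= znorm x)%N.
Proof. by rewrite /ldist (bigD1 i) //= ffunE subr0 leq_addr. Qed.

Lemma mem_box n x : reflect (forall i, (`|x i| <= n)%N) (x \in box D n).
Proof.
apply: (iffP mapP) => [[k _ ->] i|H].
  by rewrite ffunE; case: (k i) => a /= ?; lia.
have hk i : (`|(x i + n%:Z)%R| < 2 * n + 1)%N by have := H i; lia.
exists [ffun i => Ordinal (hk i)]; first by rewrite mem_enum.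
by apply/ffunP => i; rewrite !ffunE /=; have := H i; lia.
Qed.

Lemma box_uniq n : uniq (box D n).
Proof.
rewrite map_inj_uniq ?enum_uniq // => k l /ffunP H; apply/ffunP => i.
by apply: val_inj; have := H i; rewrite !ffunE => /addIr[].
Qed.

Lemma size_box n : size (box D n) = ((2 * n + 1) ^ D)%N.
Proof. by rewrite size_map -cardE card_ffun !card_ord. Qed.

Lemma mem_ball n x : (x \in Defs.ball D n) = (znorm x <= n)%N.
Proof.
rewrite !inE /= andb_idl // => h; apply/mem_box => i.
exact: leq_trans (leq_coord_znorm x i) h.
Qed.

Lemma znorm_box n x : x \in box D n -> (znorm x <= D * n)%N.
Proof.
move=> /mem_box H; rewrite -[X in (X * n)%N]card_ord -sum_nat_const.
by apply: leq_sum => i _; rewrite ffunE subr0.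
Qed.

Lemma big_uniq_sub (V : nmodType) (G : Zd D -> V) (s t : seq (Zd D)) :
  uniq s -> uniq t -> {subset t <= s} ->
  \sum_(x <- s | x \in t) G x = \sum_(x <- t) G x.
Proof.
move=> us ut ts; rewrite -big_filter; apply: perm_big; apply: uniq_perm => //.
  exact: filter_uniq.
by move=> x; rewrite mem_filter andb_idr //; exact: ts.
Qed.

(** * Summable families on the lattice and the decay that ensures summability *)

Section Tail.
Context {R : realType}.

Definition tail_le (g : Zd D -> R) (r : nat) (e : R) := forall s,
  uniq s -> (forall x, x \in s -> (r < znorm x)%N) -> \sum_(x <- s) g x <= e.

(* The Cauchy form of summability, for nonnegative g. *)
Definition tail_small (g : Zd D -> R) :=
  forall e : R, 0 < e -> exists r, tail_le g r e.

Definition abs_summable (F : Zd D -> R[i]) := tail_small (fun x => cabs (F x)).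

Lemma tail_le_mono g h r r' e e' : (forall x, (r' < znorm x)%N -> g x <= h x) ->
  (r <= r')%N -> e <= e' -> tail_le h r e -> tail_le g r' e'.
Proof.
move=> gh rr ee H s us hs; apply: le_trans ee; apply: le_trans (H s us _).
  by rewrite big_seq [leRHS]big_seq; apply: ler_sum => x xs; rewrite gh ?hs.
by move=> x xs; apply: leq_ltn_trans rr _; exact: hs.
Qed.

Lemma tail_small_le g h : (forall x, g x <= h x) -> tail_small h -> tail_small g.
Proof.
by move=> gh H e /H[r hr]; exists r; apply: tail_le_mono hr.
Qed.

Lemma tail_smallZ k g : 0 <= k -> tail_small g -> tail_small (fun x => k * g x).
Proof.
move=> k0 Hg e e0; have k1 : 0 < k + 1 by rewrite ltr_wpDl.
have [r hr] : exists r, tail_le g r (e / (k + 1)) by apply: Hg; rewrite divr_gt0.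
exists r => s us hs; rewrite -mulr_sumr.
apply: le_trans (ler_wpM2l k0 (hr s us hs)) _.
by rewrite mulrCA ler_piMr ?(ltW e0) // ler_pdivrMr // mul1r lerDl.
Qed.

Lemma powR2_lt1 (d : R) : d < 0 -> 2 `^ d < 1.
Proof.
move=> d0; rewrite -[d]opprK powRN invf_lt1 ?powR_gt0 //.
have {1}-> : 1 = 1 `^ (- d) :> R by rewrite powR1.
by rewrite gt0_ltr_powR ?nnegrE ?oppr_gt0 // ltr1n.
Qed.

Lemma powR_anti (p a b : R) : 0 <= p -> 0 < a -> a <= b ->
  b `^ (- p) <= a `^ (- p).
Proof.
move=> p0 a0 ab; have b0 := lt_le_trans a0 ab.
rewrite !powRN lef_pV2 ?posrE ?powR_gt0 //.
by rewrite ge0_ler_powR ?nnegrE ?(ltW a0) ?(ltW b0).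
Qed.

(* The dyadic shell 2^k <= |x| < 2^(k+1) has at most (8 * 2^k)^D points, so it
   contributes at most 8^D q^k with q = 2^(D-p). *)
Lemma tail_shells (p : R) (n K : nat) (s : seq (Zd D)) :
  D%:R < p -> uniq s ->
  (forall x, x \in s -> (2 ^ K <= znorm x < 2 ^ (K + n))%N) ->
  \sum_(x <- s) (znorm x)%:R `^ (- p) <=
    8 ^+ D * (2 `^ (D%:R - p)) ^+ K / (1 - 2 `^ (D%:R - p)).
Proof.
move=> pD; set q := 2 `^ (D%:R - p).
have q0 : 0 < q by rewrite powR_gt0.
have q1 : q < 1.
  by apply: powR2_lt1; rewrite subr_lt0.
have iq : 0 < (1 - q)^-1 by rewrite invr_gt0 subr_gt0.
elim: n K s => [|n IH] K s us hs.
  case: s us hs => [|x s] us hs.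
    by rewrite big_nil !mulr_ge0 ?exprn_ge0 // ltW.
  have := hs x (mem_head _ _); rewrite addn0 => /andP[h1 h2].
  by have := leq_ltn_trans h1 h2; rewrite ltnn.
rewrite (bigID (fun x => (znorm x < 2 ^ K.+1)%N)) /=.
(* The geometric bound is its first term, for the shell [K], plus the bound for the shells from
   [K.+1] on. *)
have -> : 8 ^+ D * q ^+ K / (1 - q) =
   8 ^+ D * q ^+ K + 8 ^+ D * q ^+ K.+1 / (1 - q).
  rewrite exprS; field; by rewrite gt_eqF // subr_gt0.
apply: lerD; rewrite -big_filter.
  set t := [seq _ <- _ | _].
  have ht x : x \in t -> (2 ^ K <= znorm x < 2 ^ K.+1)%N.
    by rewrite mem_filter => /andP[-> /hs/andP[->]].
  have ut : uniq t by exact: filter_uniq.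
  have st : (size t <= (8 * 2 ^ K) ^ D)%N.
    (* The shell lies in a cube of side [4 * 2 ^ K + 1], which is at most [8 * 2 ^ K]. *)
    apply: (@leq_trans (size (box D (2 ^ K.+1)))).
      apply: uniq_leq_size => // x /ht/andP[_ xl]; apply/mem_box => i.
      exact: leq_trans (leq_coord_znorm x i) (ltnW xl).
    rewrite size_box; case: (D) => // d; rewrite leq_exp2r // expnS.
    by have := expn_gt0 2 K; lia.
  apply: (@le_trans _ _ (\sum_(x <- t) (2 ^ K)%:R `^ (- p))).
    rewrite big_seq [leRHS]big_seq; apply: ler_sum => x /ht/andP[xl _].
    by apply: powR_anti; rewrite ?(le_trans _ (ltW pD)) ?ltr0n ?expn_gt0 ?ler_nat.
  rewrite big_const_seq count_predT iter_addr_0 -[_ *+ size t]mulr_natl.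
  apply: (@le_trans _ _ (((8 * 2 ^ K) ^ D)%:R * (2 ^ K)%:R `^ (- p))).
    by rewrite ler_wpM2r ?powR_ge0 // ler_nat.
  rewrite natrX natrM exprMn -mulrA ler_wpM2l ?exprn_ge0 //.
  have -> : (2 ^ K)%:R = 2 `^ K%:R :> R by rewrite powR_mulrn // natrX.
  rewrite -powR_mulrn ?powR_ge0 // -powR_mulrn ?powR_ge0 // -!powRrM.
  by rewrite -powRD ?pnatr_eq0 ?implybT // -mulrDr mulrC.
have := IH K.+1 [seq x <- s | ~~ (znorm x < 2 ^ K.+1)%N] (filter_uniq _ us).
apply => x; rewrite mem_filter -leqNgt => /andP[-> /hs/andP[_]].
by rewrite addSnnS.
Qed.

Lemma tail_small_powR (p : R) : D%:R < p ->
  tail_small (fun x => (znorm x)%:R `^ (- p)).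
Proof.
move=> pD e e0; set q := 2 `^ (D%:R - p).
have q0 : 0 < q by rewrite powR_gt0.
have q1 : q < 1.
  by apply: powR2_lt1; rewrite subr_lt0.
have d0 : 0 < e * (1 - q) / 8 ^+ D.
  by rewrite !mulr_gt0 ?invr_gt0 ?exprn_gt0 ?subr_gt0.
have /cvgrPdist_lt/(_ _ d0)[K _ HK] : (GRing.exp q) @ \oo --> (0 : R).
  by apply: cvg_expr; rewrite gtr0_norm.
exists (2 ^ K)%N => s us hs.
pose n := \max_(x <- s) znorm x.
apply: le_trans (@tail_shells p n.+1 K s pD us _) _.
  move=> x xs; rewrite ltnW ?hs //=.
  apply: (@leq_ltn_trans n); first exact: leq_bigmax_seq.
  apply: leq_trans (ltnW (ltn_expl n.+1 (isT : 1 < 2)%N)) _.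
  by rewrite leq_exp2l // leq_addl.
have := HK K (leqnn K); rewrite /= sub0r normrN gtr0_norm ?exprn_gt0 // => h.
rewrite ler_pdivrMr ?subr_gt0 // mulrC -ler_pdivlMr ?exprn_gt0 //; exact: ltW.
Qed.

(** For [znorm x > 2 * r] one has [znorm x - r >= znorm x / 2], which costs a factor [2 ^ p]. The
    constant [K] only affects finitely many points. *)
Lemma tail_small_decay (p K C : R) (r : nat) : D%:R < p -> 0 <= C ->
  tail_small (fun x => if (znorm x <= r)%N then K
                       else C * (znorm x - r)%:R `^ (- p)).
Proof.
move=> pD C0 e e0.
have p0 : 0 < p by apply: le_lt_trans pD.
have [r1 h1] := tail_smallZ (mulr_ge0 C0 (powR_ge0 2 p)) (tail_small_powR pD) e0.
exists (maxn r1 (2 * r)).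
apply: (tail_le_mono _ (leq_maxl _ _) (lexx e) h1) => x.
rewrite gtn_max => /andP[_ xr].
have -> : (znorm x <= r)%N = false by lia.
rewrite -mulrA ler_wpM2l //.
have -> : (2 : R) `^ p = 2^-1 `^ (- p) by rewrite -powR_inv1 // -powRrM mulN1r opprK.
rewrite -powRM ?invr_ge0 //.
apply: powR_anti; rewrite ?(ltW p0) ?mulr_gt0 ?invr_gt0 ?ltr0n //; first by lia.
rewrite mulrC ler_pdivrMr // -natrM ler_nat; lia.
Qed.

(** * Comparison of finite sums with [lsum], and averages over cubes *)

Section Lsum.
Variable F : Zd D -> R[i].
Implicit Types s t : seq (Zd D).

Lemma tail_le_sub r e s t : tail_le (fun x => cabs (F x)) r e ->
  uniq s -> uniq t -> {subset t <= s} ->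
  (forall x, (znorm x <= r)%N -> x \in t) ->
  cabs (\sum_(x <- s) F x - \sum_(x <- t) F x) <= e.
Proof.
move=> H us ut ts rt.
rewrite (bigID (mem t)) /= big_uniq_sub // addrC addrK -big_filter.
apply: le_trans (cabs_sum _ _) _; apply: H; first exact: filter_uniq.
move=> x; rewrite mem_filter => /andP[xt _]; rewrite ltnNge.
by apply: contra xt; exact: rt.
Qed.

Hypothesis sF : abs_summable F.

Lemma lsum_cvg : (fun n => \sum_(x <- Defs.ball D n) F x) @ \oo --> lsum F.
Proof.
apply: cauchyC_cvg => e e0; have e2 : 0 < e / 2 by rewrite divr_gt0.
have [r hr] := sF e2; exists r => m n hm hn.
apply: (@le_lt_trans _ _ (e / 2)); last first.
  by rewrite ltr_pdivrMr // ltr_pMr // ltr1n.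
wlog nm : m n hm hn / (n <= m)%N.
  by move=> W; case: (leqP n m) => [/W|/ltnW/W]; [exact|rewrite cabs_distC; exact].
apply: (tail_le_sub hr); rewrite ?fset_uniq // => x; rewrite !mem_ball => h.
  exact: leq_trans h nm.
exact: leq_trans h hn.
Qed.

(** The finite set may be any one containing the ball of radius [r]: every large ball contains it,
    and the two sums differ only beyond [r]. *)
Lemma lsum_close r e s : tail_le (fun x => cabs (F x)) r e ->
  uniq s -> (forall x, (znorm x <= r)%N -> x \in s) ->
  cabs (\sum_(x <- s) F x - lsum F) <= e.
Proof.
move=> H us hs; rewrite cabs_distC.
have h : (fun n => \sum_(x <- Defs.ball D n) F x + - (\sum_(x <- s) F x)) @ \oo -->
    lsum F - \sum_(x <- s) F x.
  by apply: cvgCD; [exact: lsum_cvg|exact: cvg_cst].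
apply: (cvgC_cabs_le h); exists (\max_(x <- s) znorm x) => n hn.
apply: (tail_le_sub H) => //; first exact: fset_uniq.
move=> x xs; rewrite mem_ball; apply: leq_trans hn; exact: leq_bigmax_seq.
Qed.

Lemma lsum_eq l : (fun n => \sum_(x <- Defs.ball D n) F x) @ \oo --> (l : R[i]) ->
  lsum F = l.
Proof. exact: limC. Qed.

Lemma abs_summable_bounded :
  exists M, forall s, uniq s -> cabs (\sum_(x <- s) F x - lsum F) <= M.
Proof.
have [r hr] := sF ltr01.
exists (\sum_(x <- Defs.ball D r) cabs (F x) + 1%R + cabs (lsum F)) => s us.
apply: le_trans (cabsB _ _) _; rewrite lerD2r.
rewrite (bigID (fun x => x \in Defs.ball D r)) /=.
apply: le_trans (cabsD _ _) _; apply: lerD.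
  rewrite -big_filter; apply: le_trans (cabs_sum _ _) _.
  rewrite [leRHS](bigID (mem s)) /= -[X in _ <= X + _]big_filter.
  rewrite (perm_big [seq x <- Defs.ball D r | x \in s]) /=.
    by rewrite lerDl; apply: sumr_ge0 => *; exact: cabs_ge0.
  apply: uniq_perm; rewrite ?filter_uniq ?fset_uniq // => x.
  by rewrite !mem_filter andbC.
rewrite -big_filter; apply: le_trans (cabs_sum _ _) _.
apply: hr; first exact: filter_uniq.
by move=> x; rewrite mem_filter mem_ball -ltnNge => /andP[].
Qed.

Lemma bernoulli_le (n : nat) (t : R) : 0 <= t <= 1 -> 1 - n%:R * t <= (1 - t) ^+ n.
Proof.
move=> /andP[t0 t1]; elim: n => [|n IH]; first by rewrite mul0r subr0 expr0.
have h : 0 <= n%:R * t ^+ 2 by rewrite mulr_ge0 // sqr_ge0.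
rewrite exprS; apply: le_trans (ler_wpM2l _ IH); last by rewrite subr_ge0.
rewrite -natr1; nra.
Qed.

(* All x in the box except a boundary layer see the whole bulk of F. *)
Lemma box_average_cvg :
  (fun m => (size (box D m))%:R^-1 *
    \sum_(x <- box D m) \sum_(y <- box D m) F (x - y)) @ \oo --> lsum F.
Proof.
apply/cvgC_iff => e e0; have e2 : 0 < e / 2 by rewrite divr_gt0.
have [r hr] := sF e2; have [M hM] := abs_summable_bounded.
have M0 : 0 <= M by apply: le_trans (hM [::] isT); exact: cabs_ge0.
(* The boundary layer is at most a fraction [D * 2r / (2m + 1)] of the cube, and each of its points
   costs an extra [M]. *)
pose c := M * D%:R * (2 * r)%:R.
have c0 : 0 <= c by rewrite !mulr_ge0.
exists (maxn r (Num.truncn (c / (e / 2))).+1) => m; rewrite geq_max => /andP[rm cm].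
pose N : R := (size (box D m))%:R.
have N0 : 0 < N by rewrite ltr0n size_box expn_gt0 addn1.
have -> : (size (box D m))%:R^-1 *
    (\sum_(x <- box D m) \sum_(y <- box D m) F (x - y)) - lsum F =
  (N^-1)%:C%C * \sum_(x <- box D m) (\sum_(y <- box D m) F (x - y) - lsum F).
  rewrite sumrB mulrBr [X in _ - _ * X]big_const_seq count_predT iter_addr_0.
  rewrite -[lsum F *+ _]mulr_natl fmorphV rmorph_nat mulKf //.
  by rewrite pnatr_eq0 -lt0n -(ltr0n R).
rewrite cabsM cabsR ?invr_ge0 ?(ltW N0) // mulrC ltr_pdivrMr //.
apply: le_lt_trans (cabs_sum _ _) _.
have step x : x \in box D m ->
   cabs (\sum_(y <- box D m) F (x - y) - lsum F) <= 
   e / 2 + M - (if x \in box D (m - r) then M else 0).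
  move=> xm; rewrite -(big_map (fun y => x - y) xpredT F).
  have um : uniq (map (fun y => x - y) (box D m)).
    by rewrite map_inj_uniq ?box_uniq // => y y' /addrI/oppr_inj.
  case: ifPn => [xr|_]; last by rewrite subr0 (le_trans (hM _ um)) // lerDr ltW.
  rewrite addrK; apply: (lsum_close hr um) => z zr; apply/mapP; exists (x - z).
    apply/mem_box => i; rewrite !ffunE; move/mem_box: xr => /(_ i).
    have := leq_trans (leq_coord_znorm z i) zr.
    by move: (x i : int) (z i : int) => a b; lia.
  by rewrite opprB addrC subrK.
apply: (@le_lt_trans _ _ (\sum_(x <- box D m)
    (e / 2 + M - (if x \in box D (m - r) then M else 0)))).
  by rewrite big_seq [leRHS]big_seq; apply: ler_sum.
have sub : {subset box D (m - r) <= box D m}.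
  move=> x /mem_box h; apply/mem_box => i.
  by apply: leq_trans (h i) _; exact: leq_subr.
rewrite sumrB -big_mkcond big_uniq_sub ?box_uniq //.
rewrite !big_const_seq !count_predT !iter_addr_0.
rewrite -[(_ + _) *+ _]mulr_natr -[M *+ _]mulr_natr -/N.
(* The inner and outer cubes have sides in ratio [1 - t]; Bernoulli's inequality bounds the loss of
   volume by [D * t]. *)
pose t : R := (2 * r)%:R / (2 * m + 1)%:R.
have s0 : 0 < (2 * m + 1)%:R :> R by rewrite ltr0n addn1.
have t01 : 0 <= t <= 1.
  by rewrite divr_ge0 // ler_pdivrMr // mul1r ler_nat; lia.
have Nr : (size (box D (m - r)))%:R = N * (1 - t) ^+ D.
  rewrite /N !size_box !natrX -exprMn; congr (_ ^+ _).
  rewrite mulrBr mulr1 mulrCA mulfV ?gt_eqF // mulr1 -natrB; last by lia.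
  by congr (_%:R); lia.
rewrite Nr.
have B := bernoulli_le D t01.
have : M * (D%:R * t) < e / 2.
  have -> : M * (D%:R * t) = c / (2 * m + 1)%:R by rewrite /t /c !mulrA.
  rewrite ltr_pdivrMr // mulrC -ltr_pdivrMr //.
  apply: lt_le_trans (truncnS_gt _) _; rewrite ler_nat.
  by apply: leq_trans cm _; rewrite mulSn mul1n -addnA leq_addr.
move=> h.
have -> : (e / 2 + M) * N - M * (N * (1 - t) ^+ D) =
    N * (e / 2 + M * (1 - (1 - t) ^+ D)).
  by ring.
rewrite [e * N]mulrC ltr_pM2l // [ltRHS](splitr e) ltrD2l.
apply: le_lt_trans h; rewrite ler_wpM2l //; lra.
Qed.

End Lsum.

Lemma lsumD (F G : Zd D -> R[i]) : abs_summable F -> abs_summable G ->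
  lsum (fun x => F x + G x) = lsum F + lsum G.
Proof.
move=> sF sG; apply: lsum_eq; under eq_fun do rewrite big_split /=.
by apply: cvgCD; exact: lsum_cvg.
Qed.

Lemma lsumZ k (F : Zd D -> R[i]) : abs_summable F ->
  lsum (fun x => k * F x) = k * lsum F.
Proof.
move=> sF; apply: lsum_eq; under eq_fun do rewrite -mulr_sumr /=.
by apply: cvgCM; exact: lsum_cvg.
Qed.

End Tail.
End Lattice.

(** * Clustering states and pseudolocal charges *)

Section QuasiLocalState.
Context {R : realType} {D : nat} {O : algType R[i]}.
Context {star : O -> O} {nrm : O -> R} {OX : {fset Zd D} -> set O}.
Context {iota : Zd D -> O -> O} {omega : O -> R[i]}.
Context {nu f : nat -> R} {p : R}.
Hypothesis HO : quasi_local star nrm OX iota.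
Hypothesis Hom : clustering_state star nrm OX iota omega nu f p.

Notation znorm x := (ldist x 0%R).
Notation ball := Defs.ball.

(** * The involution and the state *)

Lemma star1 : star 1 = 1.
Proof. by have := star_mul HO (star 1) 1; rewrite mulr1 (star_invol HO) mulr1. Qed.

Lemma starZ k a : star (k *: a) = Num.conj k *: star a.
Proof. exact: (star_scale HO). Qed.

Lemma star0 : star 0 = 0.
Proof. by have := starZ 0 0; rewrite conjC0 !scale0r. Qed.

Lemma starB a b : star (a - b) = star a - star b.
Proof.
by rewrite (star_add HO) -scaleN1r starZ conjCN1 scaleN1r.
Qed.

Lemma star_sum (I : Type) (s : seq I) (F : I -> O) :
  star (\sum_(x <- s) F x) = \sum_(x <- s) star (F x).
Proof. exact: (big_morph star (star_add HO) star0). Qed.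

Lemma iota_id a : iota 0 a = a.
Proof.
have [g gK _] := iota_bij HO 0.
by apply: (can_inj gK); rewrite (iota_comp HO) addr0.
Qed.

Lemma omega_0 : omega 0 = 0.
Proof. by rewrite -(scale0r (1 : O)) (omega_scale Hom) mul0r. Qed.

Lemma omegaB a b : omega (a - b) = omega a - omega b.
Proof. by rewrite (omega_add Hom) -scaleN1r (omega_scale Hom) mulN1r. Qed.

Lemma omega_sum (I : Type) (s : seq I) (F : I -> O) :
  omega (\sum_(x <- s) F x) = \sum_(x <- s) omega (F x).
Proof. exact: (big_morph omega (omega_add Hom) omega_0). Qed.

(** The semi-inner product of the GNS construction. *)
Definition state_form a b := omega (star a * b).

Lemma psd_state_form : psd_form state_form.
Proof.
split=> *; rewrite /state_form.
- by rewrite (star_add HO) mulrDl (omega_add Hom).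
- by rewrite mulrDr (omega_add Hom).
- by rewrite starZ -scalerAl (omega_scale Hom).
- by rewrite -scalerAr (omega_scale Hom).
- exact: (omega_pos Hom).
Qed.

Lemma omega_star a : omega (star a) = Num.conj (omega a).
Proof.
have := psd_herm psd_state_form 1 a.
by rewrite /state_form star1 mulr1 mul1r.
Qed.

Lemma state_CS a b : cabs (omega (star a * b)) ^+ 2 <=
  complex.Re (omega (star a * a)) * complex.Re (omega (star b * b)).
Proof.
have := psd_CS_sqr psd_state_form a b; rewrite /state_form.
by rewrite !sqr_sqrtr // Re_ge0 // (omega_pos Hom).
Qed.

Lemma cabs_omega a : cabs (omega a) <= nrm a.
Proof. by have := omega_bounded Hom a; rewrite cabsE lecR. Qed.

Lemma nrm_ge0 a : 0 <= nrm a.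
Proof. exact: le_trans (cabs_ge0 _) (cabs_omega a). Qed.

(** * Supports and localization *)

(** A localizing set of least cardinality is contained in every other one, because the intersection
    of the two still localizes [a]. *)
Lemma minimal_support a :
  exists X, OX X a /\ forall Y, OX Y a -> (X `<=` Y)%fset.
Proof.
have ex : exists n, `[< exists X, OX X a /\ #|` X| = n >].
  by have [X hX] := OX_cover HO a; exists #|` X|; apply/asboolP; exists X.
case: (ex_minnP ex) => n /asboolP[X [hX cX]] nmin; exists X; split=> // Y hY.
have hXY : OX (X `&` Y)%fset a by apply/(OX_cap HO).
have le : (#|` X| <= #|` (X `&` Y)%fset|)%N.
  by rewrite cX nmin //; apply/asboolP; exists (X `&` Y)%fset.
apply/fsetIidPl; apply/eqP; rewrite eqEfcard fsubsetIl //.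
Qed.

Lemma OX_supp a : OX (supp OX a) a.
Proof. by have /(xgetPex fset0)[] := minimal_support a. Qed.

Lemma supp_min a Y : OX Y a -> (supp OX a `<=` Y)%fset.
Proof. by have /(xgetPex fset0)[_] := minimal_support a; exact. Qed.

Lemma supp_fset0 a : supp OX a = fset0 -> exists c : R[i], a = c%:A.
Proof. by move=> h; apply/(OX_empty HO); rewrite -h; exact: OX_supp. Qed.

Lemma OX_iota X x a : OX X a -> OX (fshift X x) (iota x a).
Proof.
move=> /supp_min/fsubsetP h; apply: (OX_mono HO) (OX_supp (iota x a)).
rewrite (iota_supp HO); apply/fsubsetP => z /imfsetP[y /= ys ->].
by apply/imfsetP; exists y => //; exact: h.
Qed.

Lemma OX_sum X (I : Type) (s : seq I) (F : I -> O) (P : pred I) :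
  (forall i, P i -> OX X (F i)) -> OX X (\sum_(i <- s | P i) F i).
Proof.
move=> H; apply: big_ind => //; last exact: (OX_add HO).
by rewrite -(scale0r 1); apply: (OX_scale HO); exact: (OX_one HO).
Qed.

(** One integer bounds both the radius and the norm, so that uniform estimates have a single index
    for the diagonal argument. *)
Lemma radiusP a : exists l : nat, OX (ball D l) a /\ nrm a <= l%:R.
Proof.
have [X hX] := OX_cover HO a.
exists (maxn (\max_(x <- X) znorm x) (Num.truncn (nrm a)).+1); split.
  apply: (OX_mono HO) hX; apply/fsubsetP => x xX; rewrite mem_ball leq_max.
  by rewrite (@leq_bigmax_seq _ _ xpredT (fun x => znorm x)).
by apply: le_trans (ltW (truncnS_gt _)) _; rewrite ler_nat leq_maxr.
Qed.

(** [fdist] is an [xget] with default 0; nonemptiness guarantees that the minimum exists and is the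
    value chosen. *)
Lemma fdist_ge (X Y : {fset Zd D}) d : X != fset0 -> Y != fset0 ->
  (forall x y, x \in X -> y \in Y -> (d <= ldist x y)%N) -> (d <= fdist X Y)%N.
Proof.
move=> /fset0Pn[x0 hx0] /fset0Pn[y0 hy0] H.
have ex : exists n, `[< exists x y, x \in X /\ y \in Y /\ ldist x y = n >].
  by exists (ldist x0 y0); apply/asboolP; exists x0, y0.
rewrite /fdist.
set P := fun d : nat => _.
have : P (xget 0%N P).
  apply: xgetPex; case: (ex_minnP ex) => n /asboolP h nmin; exists n; split=> //.
  by move=> x y xX yY; apply: nmin; apply/asboolP; exists x, y.
by move=> [[x [y [xX [yY <-]]]] _]; exact: H.
Qed.

(** * Truncated correlations and their summability *)

Definition corr a b z := omega (iota z a * b) - omega a * omega b.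

Lemma omega_iota2 x y a b :
  omega (iota x a * iota y b) - omega a * omega b = corr a b (x - y).
Proof.
congr (_ - _); rewrite -(omega_transl Hom (- y)) (iota_mul HO) !(iota_comp HO).
by rewrite addNr iota_id addrC.
Qed.

Lemma corr_scalar c b z : corr c%:A b z = 0.
Proof.
rewrite /corr (iota_scale HO) (iota_one HO) -scalerAl mul1r !(omega_scale Hom).
by rewrite (omega_one Hom) mulr1 subrr.
Qed.

Lemma corr_scalar_r c a z : corr a c%:A z = 0.
Proof.
rewrite /corr -scalerAr mulr1 !(omega_scale Hom) (omega_transl Hom).
by rewrite (omega_one Hom) mulr1 mulrC subrr.
Qed.

(** The clustering bound sees [a] only through its norm and the size and position of its support, so
    one summable majorant serves all [a] of radius and norm at most [L]. The diagonal construction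
    relies on this uniformity. *)
Lemma corr_dominated (L : nat) b : exists g : Zd D -> R, tail_small g /\
  forall a, OX (ball D L) a -> nrm a <= L%:R -> forall z, cabs (corr a b z) <= g z.
Proof.
have [rb [hb nb]] := radiusP b.
pose r := (L + rb)%N.
pose l := (maxn #|` ball D L| #|` ball D rb|).+1.
pose C := nu l * L%:R * nrm b.
have C0 : 0 <= C by rewrite !mulr_ge0 ?(nu_ge0 Hom) ?nrm_ge0.
have p0 : 0 <= p by apply: le_trans (ltW (p_gtD Hom)).
eexists; split.
  exact: (tail_small_decay (2 * (L%:R * nrm b)) r (p_gtD Hom) C0).
move=> a ha na z /=.
(* Up to [r] the supports may meet and only the norm bound is available; beyond it they are at
   distance at least [znorm z - r > 0]. *)
case: leqP => zr.
  apply: le_trans (cabsB _ _) _; rewrite mulr_natl mulr2n lerD //.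
    apply: le_trans (cabs_omega _) _; apply: le_trans (nrm_mul HO _ _) _.
    by rewrite (iota_nrm HO) ler_wpM2r ?nrm_ge0.
  rewrite cabsM ler_pM ?cabs_ge0 ?cabs_omega //.
  exact: le_trans (cabs_omega _) na.
(* Clustering concerns nonempty supports; an empty one means a scalar, whose correlations vanish. *)
have [/supp_fset0[c ->]|sa] := eqVneq (supp OX a) fset0.
  by rewrite corr_scalar cabs0 mulr_ge0 ?powR_ge0.
have [/supp_fset0[c ->]|sb] := eqVneq (supp OX b) fset0.
  by rewrite corr_scalar_r cabs0 mulr_ge0 ?powR_ge0.
have sia : supp OX (iota z a) != fset0.
  rewrite (iota_supp HO); have /fset0Pn[x xa] := sa; apply/fset0Pn.
  by exists (x + z); apply/imfsetP; exists x.
have ca : (#|` supp OX (iota z a)| < l)%N.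
  rewrite (iota_supp HO) ltnS leq_max card_imfset /=; last exact: addIr.
  by rewrite (fsubset_leq_card (supp_min ha)).
have cb : (#|` supp OX b| < l)%N.
  by rewrite ltnS leq_max (fsubset_leq_card (supp_min hb)) orbT.
have := clustering Hom ca cb sia sb.
rewrite (omega_transl Hom) (iota_nrm HO) cabsE lecR => h; apply: le_trans h _.
have dist : (znorm z - r <= fdist (supp OX (iota z a)) (supp OX b))%N.
  apply: fdist_ge => // x y; rewrite (iota_supp HO) => /imfsetP[x' /= xa ->] yb.
  have := fsubsetP (supp_min ha) _ xa; have := fsubsetP (supp_min hb) _ yb.
  rewrite !mem_ball => h1 h2; rewrite (ldistE (x' + z)).
  have E : z = x' + z - y + (y - x') by rewrite addrA subrK addrAC subrr add0r.
  have := znormD (x' + z - y) (y - x'); rewrite -E.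
  have := znormD y (- x'); rewrite znormN /r.
  move: h1 h2.
  move: (znorm z) (znorm (x' + z - y)) (znorm (y - x')) (znorm y) (znorm x').
  by move=> *; lia.
have d0 : (0 < znorm z - r)%N by rewrite subn_gt0.
have hf : f (fdist (supp OX (iota z a)) (supp OX b)) <= (znorm z - r)%:R `^ (- p).
  apply: le_trans (f_decay Hom (leq_trans d0 dist)) _.
  by rewrite powR_anti ?ltr0n ?ler_nat.
apply: ler_pM => //; rewrite ?mulr_ge0 ?(nu_ge0 Hom) ?nrm_ge0 ?(f_ge0 Hom) //.
by rewrite /C ler_wpM2r ?nrm_ge0 // ler_wpM2l ?(nu_ge0 Hom).
Qed.

Lemma corr_summable a b : abs_summable (corr a b).
Proof.
have [l [hl nl]] := radiusP a; have [g [tg hg]] := corr_dominated l b.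
by apply: tail_small_le tg => z; exact: hg.
Qed.

Notation B := (formS star iota omega).

Lemma formSE a b : B a b = lsum (corr b (star a)).
Proof. 
rewrite /formS /form; congr lsum; apply/funext => x.
by rewrite -(iota_star HO) !(star_invol HO).
 Qed.

(** * Sums of translates over cubes and their variance *)

Notation fsum a m := (\sum_(x <- box D m) iota x a).

(** [Qp omega Q n] is convertible with [centered (Q n)]. *)
Definition centered c := c - omega c *: 1.

Lemma omega_mul_centered a b :
  omega (a * centered b) = omega (a * b) - omega a * omega b.
Proof.
rewrite /centered mulrBr omegaB -scalerAr mulr1 (omega_scale Hom).
by rewrite [X in _ - X]mulrC.
Qed.

Lemma star_centered a : star (centered a) = centered (star a).
Proof. by rewrite /centered starB starZ star1 omega_star. Qed.

Lemma omega_centered a : omega (centered a) = 0.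
Proof. by rewrite omegaB (omega_scale Hom) (omega_one Hom) mulr1 subrr. Qed.

Lemma omega_fsum a m : omega (fsum a m) = omega a *+ size (box D m).
Proof.
rewrite omega_sum; under eq_bigr do rewrite (omega_transl Hom).
by rewrite big_const_seq count_predT iter_addr_0.
Qed.

(** Both the variance of a cube sum and the charge produced by cube sums are computed from this
    identity. *)
Lemma omega_fsum_star x b u m :
  omega (iota x b * centered (star (fsum u m))) =
  \sum_(y <- box D m) corr b (star u) (x - y).
Proof.
rewrite omega_mul_centered (omega_transl Hom) star_sum.
under eq_bigr do rewrite -(iota_star HO).
rewrite omega_fsum mulr_sumr omega_sum mulrnAr -iter_addr_0.
rewrite -(count_predT (box D m)) -big_const_seq -sumrB.
by apply: eq_bigr => y _; rewrite omega_iota2.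
Qed.

Lemma variance_E a m :
  omega (centered (fsum a m) * star (centered (fsum a m))) =
  \sum_(x <- box D m) \sum_(y <- box D m) corr a (star a) (x - y).
Proof.
rewrite star_centered.
rewrite [RHS](eq_bigr (fun x =>
    omega (iota x a * centered (star (fsum a m))))); last first.
  by move=> x _; rewrite omega_fsum_star.
(* Centering the left factor changes nothing, since the right factor already has mean zero. *)
rewrite -omega_sum -mulr_suml /centered mulrBl omegaB -scalerAl mul1r.
rewrite (omega_scale Hom).
by rewrite -/(centered (star (fsum a m))) omega_centered mulr0 subr0.
Qed.

Lemma variance_ge0 c : 0 <= omega (c * star c).
Proof. by rewrite -{1}[c](star_invol HO) (omega_pos Hom). Qed.

(** The form is the limiting variance per unit volume. This gives its positivity and the volume
    bounds on cube sums. *)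
Lemma variance_cvg a :
  (fun m => (size (box D m))%:R^-1 *
     omega (centered (fsum a m) * star (centered (fsum a m)))) @ \oo --> B a a.
Proof.
rewrite formSE; under eq_fun do rewrite variance_E.
exact: box_average_cvg (corr_summable _ _).
Qed.

Lemma psd_formS : psd_form B.
Proof.
split=> *; rewrite ?formSE.
- rewrite (star_add HO) -lsumD; try exact: corr_summable.
  congr lsum; apply/funext => x; rewrite /corr mulrDr !(omega_add Hom) mulrDr.
  by rewrite opprD addrACA.
- rewrite -lsumD; try exact: corr_summable.
  congr lsum; apply/funext => x.
  rewrite /corr (iota_add HO) mulrDl !(omega_add Hom) mulrDl.
  by rewrite opprD addrACA.
- rewrite starZ -lsumZ; last exact: corr_summable.
  congr lsum; apply/funext => x; rewrite /corr -scalerAr !(omega_scale Hom).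
  by rewrite mulrBr mulrCA.
- rewrite -lsumZ; last exact: corr_summable.
  congr lsum; apply/funext => x.
  rewrite /corr (iota_scale HO) -scalerAl !(omega_scale Hom).
  by rewrite mulrBr mulrA.
- rewrite -formSE; apply: limC_ge0 (@variance_cvg _) _ => m.
  by rewrite mulr_ge0 ?invr_ge0 ?ler0n ?variance_ge0.
Qed.

Lemma variance_le a (d : R) : 0 < d -> exists N, forall m, (N <= m)%N ->
  complex.Re (omega (centered (fsum a m) * star (centered (fsum a m)))) <=
    (size (box D m))%:R * (fnorm B a ^+ 2 + d).
Proof.
move=> d0; have /cvgC_iff/(_ _ d0)[N var] := @variance_cvg a.
exists N => m /var; rewrite (fnorm_sqr psd_formS).
have s0 : 0 < (size (box D m))%:R :> R by rewrite ltr0n size_box expn_gt0 addn1.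
have -> : (size (box D m))%:R^-1 = ((size (box D m))%:R^-1 : R)%:C%C.
  by rewrite fmorphV rmorph_nat.
rewrite (ger0_Re (variance_ge0 (centered (fsum a m)))) -rmorphM -rmorphB /= => h.
have := le_lt_trans (Re_le_cabs _) h; rewrite /= ltrBlDl => /ltW.
by rewrite ler_pdivrMl.
Qed.

(** * Pseudolocal charges are bounded for the seminorm *)

Lemma pseudolocal_bounded Q : pseudolocal star OX iota omega Q ->
  exists C : R, 0 <= C /\
    forall a, cabs (Qomega star omega Q (star a)) <= C * fnorm B a.
Proof.
case=> _ [gamma [g0 HI]] HII [k [/andP[k0 k1] HIII]].
(* With [m] the integer part of [n / K], the cube of radius [m] has norms at most [D * m <= k * n],
   and [n < K * (m + 1)] bounds [n ^ D] by [K ^ D] times its volume. [D.+1] keeps [K] positive for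
   every [D]. *)
pose K : R := D.+1%:R / k.
have K0 : 0 < K by rewrite divr_gt0.
pose C := Num.sqrt (gamma * K ^+ D).
have C2 : C ^+ 2 = gamma * K ^+ D by rewrite sqr_sqrtr // mulr_ge0 ?exprn_ge0 ?ltW.
have C0 : 0 <= C by exact: sqrtr_ge0.
exists C; split=> // a; set s := fnorm B a; set l := Qomega _ _ _ _.
have s0 : 0 <= s by exact: fnorm_ge0.
apply/ler_addgt0Pl => e e0.
have e3 : 0 < e / 3 by rewrite divr_gt0.
(* Chosen so that [C ^+ 2 * d <= (e / 3) ^+ 2]. *)
pose d := (e / 3) ^+ 2 / (C ^+ 2 + 1).
have c1 : 0 < C ^+ 2 + 1 by rewrite ltr_wpDl ?sqr_ge0.
have d0 : 0 < d by rewrite divr_gt0 ?exprn_gt0.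
have [N1 var] := variance_le a d0.
have /cvgC_iff/(_ _ e3)[N2 lim2] :
    (fun n => omega (star (Qp omega Q n) * star a)) @ \oo --> l.
  exact: HII.
have [N3 inv] := HIII (star a) _ e3.
pose n := maxn 1 (maxn (Num.truncn (N1%:R * K)).+1 (maxn N2 N3)).
have n1 : (0 < n)%N by rewrite leq_max.
have {}lim2 := lim2 n; have {}inv := inv n.
have n2 : (N2 <= n)%N by rewrite !leq_max leqnn !orbT.
have n3 : (N3 <= n)%N by rewrite !leq_max leqnn !orbT.
have nN1 : N1%:R * K < n%:R.
  by apply: lt_le_trans (truncnS_gt _) _; rewrite ler_nat !leq_max leqnn !orbT.
pose m := Num.truncn (n%:R / K).
have nK0 : 0 <= n%:R / K by rewrite divr_ge0 // ltW.
have /andP[mle mgt] := truncn_itv nK0; rewrite -/m in mle mgt.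
have mN1 : (N1 <= m)%N.
  by rewrite -ltnS -(ltr_nat R); apply: lt_trans mgt; rewrite ltr_pdivlMr.
pose N : R := (size (box D m))%:R.
have N0 : 0 < N by rewrite ltr0n size_box expn_gt0 addn1.
pose q := Qp omega Q n; pose S := fsum a m.
have q0 c : omega (star q * centered c) = omega (star q * c).
  by rewrite omega_mul_centered star_centered omega_centered mul0r subr0.
have hV : complex.Re (omega (centered S * star (centered S))) <= N * (s ^+ 2 + d).
  exact: var.
have hQ : complex.Re (omega (star q * q)) <= gamma * (K ^+ D * N).
  have := HI n n1; rewrite -/q lecE /= => /andP[_ h]; apply: le_trans h _.
  rewrite ler_wpM2l ?(ltW g0) // /N size_box natrX -exprMn.
  apply: lerXn2r; rewrite ?nnegrE //.
    by apply: mulr_ge0 => //; exact: ltW.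
  rewrite mulrC -ler_pdivrMr //; apply: le_trans (ltW mgt) _.
  by rewrite ler_nat addn1 ltnS leq_pmull.
(* Cauchy-Schwarz: condition (I) and the variance each contribute one factor of the volume [N],
   hence [N] after the square root. *)
have hT : cabs (omega (star q * star S)) <= N * (C * s + e / 3).
  rewrite -q0 -star_centered -(ler_pXn2r (n := 2)) ?nnegrE ?cabs_ge0 //; last first.
    by rewrite mulr_ge0 ?(ltW N0) // addr_ge0 ?(ltW e3) // mulr_ge0.
  apply: le_trans (state_CS _ _) _; rewrite (star_invol HO).
  apply: le_trans (ler_pM _ _ hQ hV) _;
    rewrite ?Re_ge0 ?(omega_pos Hom) ?variance_ge0 //.
  have -> : gamma * (K ^+ D * N) * (N * (s ^+ 2 + d)) =
      N ^+ 2 * (C ^+ 2 * (s ^+ 2 + d)).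
    by rewrite C2; ring.
  rewrite [leRHS]exprMn ler_wpM2l ?sqr_ge0 //.
  have h1 : C ^+ 2 * d <= (e / 3) ^+ 2.
    rewrite /d mulrA [_ * (e / 3) ^+ 2]mulrC -mulrA ler_piMr ?sqr_ge0 //.
    by rewrite ler_pdivrMr // mul1r lerDl.
  have h2 : 0 <= C * s * (e / 3) by rewrite !mulr_ge0 // ltW.
  by move: h1 h2; move: (e / 3) => e' h1 h2; rewrite mulrDr sqrrD exprMn; lra.
(* Condition (III) compares each translate in the cube with the one at 0. *)
have hsum : cabs (omega (star q * star S) - N%:C%C * omega (star q * star a)) <=
    N * (e / 3).
  have -> : omega (star q * star S) - N%:C%C * omega (star q * star a) =
     \sum_(x <- box D m)
       (omega (star q * iota x (star a)) - omega (star q * star a)).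
    rewrite sumrB /S star_sum mulr_sumr omega_sum; congr (_ - _).
      by apply: eq_bigr => x _; rewrite (iota_star HO).
    by rewrite big_const_seq count_predT iter_addr_0 rmorph_nat mulr_natl.
  apply: le_trans (cabs_sum _ _) _.
  apply: (@le_trans _ _ (\sum_(x <- box D m) e / 3)); last first.
    by rewrite big_const_seq count_predT iter_addr_0 -[_ *+ size _]mulr_natl.
  rewrite big_seq [leRHS]big_seq; apply: ler_sum => x xm; apply: ltW.
  have := inv n3 x 0; rewrite -/q cabsE ltcR iota_id; apply.
    apply: (@le_trans _ _ ((D.+1)%:R * m%:R)).
      by rewrite -natrM ler_nat (leq_trans (znorm_box xm)) // leq_mul2r leqnSn orbT.
    rewrite mulrC -ler_pdivlMr //; apply: le_trans mle _.
    by rewrite /K invf_div mulrA [n%:R * k]mulrC.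
  have -> : ldist (0 : Zd D) 0 = 0%N.
    by rewrite /ldist big1 // => i _; rewrite !ffunE subrr.
  by rewrite mulr_ge0 // ltW.
have hA : cabs (omega (star q * star a)) <= C * s + e / 3 + e / 3.
  rewrite -(ler_pM2l N0) -{1}(cabsR (ltW N0)) -cabsM mulrDr.
  set w := N%:C%C * _ in hsum *.
  rewrite -(subrK (omega (star q * star S)) w) addrC.
  apply: le_trans (cabsD _ _) _; rewrite lerD //.
  by rewrite cabs_distC.
have := lim2 n2; rewrite -/q cabs_distC => h.
rewrite -(subrK (omega (star q * star a)) l).
apply: le_trans (cabsD _ _) _.
move: h hA; move: (cabs _) (cabs _) (C * s) => *; lra.
Qed.

(** * Pseudolocal sequences with a prescribed charge *)

(** The threshold depends on [u], [l] and [e] but not on [b] or [x]. Taking the adjoint of the cube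
    sum makes its charge linear in [b] and equal to [B u b]. *)
Lemma local_charge (u : O) (l : nat) (e : R) : 0 < e ->
  exists N, forall n, (N <= n)%N ->
    let Q := star (fsum u (n %/ D.+1)) in
    [/\ OX (ball D n) Q,
        omega (star (centered Q) * centered Q) <=
          ((fnorm B u ^+ 2 + e) * 3 ^+ D * n%:R ^+ D)%:C%C &
        forall b, OX (ball D l) b -> nrm b <= l%:R ->
          forall x, (2 * D.+1 * znorm x <= n)%N ->
            cabs (omega (iota x b * centered Q) - B u b) <= e].
Proof.
move=> e0.
have [ru [hu _]] := radiusP u.
have [N1 var] := variance_le u e0.
have [g [tg hg]] := corr_dominated l (star u).
have [r hr] := tg _ e0.
(* The factor [D.+1] turns these into lower bounds for [m]: [ru <= m] keeps the translates inside
   the ball of radius [n], and [2 * r <= m] leaves room for the shift by [x]. [n >= 1] gives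
   [2 * m + 1 <= 3 * n]. *)
exists (maxn 1 (maxn ru (maxn N1 (2 * r)) * D.+1))%N => n.
rewrite geq_max -leq_divRL //; set m := (n %/ D.+1)%N.
rewrite !geq_max => /andP[n1 /and3P[rum N1m rm]] Q.
have mn : (D.+1 * m <= n)%N by rewrite mulnC leq_divM.
pose N : R := (size (box D m))%:R.
have N0 : 0 < N by rewrite ltr0n size_box expn_gt0 addn1.
split.
- apply: (OX_star HO); rewrite big_seq; apply: OX_sum => x xm.
  apply: (OX_mono HO) (OX_iota x hu); apply/fsubsetP => y /imfsetP[z /= zu ->].
  move: zu; rewrite !mem_ball => zu; apply: leq_trans (znormD _ _) _.
  by apply: leq_trans (leq_add zu (znorm_box xm)) _; rewrite mulSn in mn; lia.
- rewrite /Q -star_centered (star_invol HO).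
  rewrite (ger0_Re (variance_ge0 (centered (fsum u m)))) lecR.
  apply: le_trans (var m N1m) _.
  rewrite mulrC -mulrA ler_wpM2l ?addr_ge0 ?sqr_ge0 ?(ltW e0) //.
  rewrite /N size_box natrX -exprMn lerXn2r ?nnegrE ?mulr_ge0 //.
  by rewrite -natrM ler_nat; rewrite mulSn in mn; lia.
- move=> b hb nb x xn; rewrite /Q omega_fsum_star formSE.
  rewrite -(big_map (fun y => x - y) xpredT (corr b (star u))).
  apply: (lsum_close (corr_summable _ _) (r := r)).
  + apply: tail_le_mono hr => // z _; exact: hg.
  + by rewrite map_inj_uniq ?box_uniq // => y y' /addrI/oppr_inj.
  (* Both [znorm x] and [r] are at most [m / 2], so the shifted cube still contains the ball of
     radius [r]. *)
  + move=> z zr; apply/mapP; exists (x - z); last by rewrite opprB addrC subrK.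
    apply/mem_box => i; apply: leq_trans (leq_coord_znorm _ _) _.
    apply: leq_trans (znormD _ _) _; rewrite znormN.
    have : (2 * znorm x <= m)%N by rewrite leq_divRL // mulnAC.
    lia.
Qed.

(** [J n] is the largest [j <= n] with [N j <= n]; from [N 0] on, [j = 0] qualifies, so the maximum
    is attained. *)
Lemma slow_diagonal (N : nat -> nat) : exists J : nat -> nat,
  (forall j, exists n0, forall n, (n0 <= n)%N -> (j <= J n)%N) /\
  (forall n, (N 0%N <= n)%N -> (N (J n) <= n)%N).
Proof.
exists (fun n => \max_(j < n.+1 | (N j <= n)%N) j); split.
  move=> j; exists (maxn j (N j)) => n; rewrite geq_max => /andP[jn Nj].
  have jn' : (j < n.+1)%N by [].
  exact: (@leq_bigmax_cond _ (fun i : 'I_n.+1 => (N i <= n)%N)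
    (fun i => i : nat) (Ordinal jn')).
move=> n N0.
have c0 : (0 < #|[pred i : 'I_n.+1 | (N i <= n)%N]|)%N.
  by apply/card_gt0P; exists ord0.
by have [i hi ->] := eq_bigmax_cond (fun i : 'I_n.+1 => (i : nat)) c0.
Qed.

Lemma charge_of_bounded_sequence (v : nat -> O) (M : R) (G : O -> R[i]) :
  (forall j, fnorm B (v j) <= M) ->
  (forall b, (fun j => B (v j) b) @ \oo --> G b) ->
  Qstar_set star OX iota omega G.
Proof.
move=> vM vG.
have M0 : 0 <= M by apply: le_trans (vM 0%N); exact: fnorm_ge0.
have inv0 j : 0 < j.+1%:R^-1 :> R by rewrite invr_gt0.
(* Stage [j] treats all observables of radius and norm at most [j] with precision [1 / (j + 1)], so
   each observable is eventually covered. *)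
have /choice[N HN] := fun j => local_charge (v j) j (inv0 j).
have [J [Jinf JN]] := slow_diagonal N.
pose Q n := if (N 0%N <= n)%N then star (fsum (v (J n)) (n %/ D.+1)) else 0.
have QE n : (N 0%N <= n)%N -> Q n = star (fsum (v (J n)) (n %/ D.+1)).
  by rewrite /Q => ->.
(* Uniformity in [x] serves twice: [x = 0] yields the limit (II), and comparing two values of [x]
   yields (III). *)
have conv b (e : R) : 0 < e -> exists n0, forall n, (n0 <= n)%N ->
    forall x, (2 * D.+1 * znorm x <= n)%N ->
    cabs (omega (iota x b * Qp omega Q n) - G b) < e.
  move=> e0; have e2 : 0 < e / 2 by rewrite divr_gt0.
  have [l [hl nl]] := radiusP b.
  have /cvgC_iff/(_ _ e2)[N1 h1] := vG b.
  have [n0 h0] := Jinf (maxn l (maxn N1 (Num.truncn (e / 2)^-1))).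
  exists (maxn (N 0%N) n0) => n; rewrite geq_max => /andP[N0n /h0].
  rewrite !geq_max => /and3P[lJ N1J eJ] x xn.
  have [_ _ /(_ b)] := HN (J n) n (JN _ N0n).
  rewrite -QE // => /(_ _ _ x xn) h.
  rewrite -(subrK (B (v (J n)) b) (omega _)) -addrA.
  apply: le_lt_trans (cabsD _ _) _; rewrite (splitr e) ler_ltD ?h1 //.
  apply: le_trans (h _ _) _.
  - apply: (OX_mono HO) hl; apply/fsubsetP => y; rewrite !mem_ball => yl.
    exact: leq_trans yl lJ.
  - by apply: le_trans nl _; rewrite ler_nat.
  - rewrite -[e / 2]invrK lef_pV2 ?posrE ?invr_gt0 //.
    apply: le_trans (ltW (truncnS_gt _)) _; by rewrite ler_nat ltnS.
have cstar n x a : omega (star (Qp omega Q n) * iota x a) =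
    Num.conj (omega (iota x (star a) * Qp omega Q n)).
  by rewrite -omega_star (star_mul HO) -(iota_star HO) (star_invol HO).
have lim a : (fun n => omega (star (Qp omega Q n) * a)) @ \oo -->
    Num.conj (G (star a)).
  apply/cvgC_iff => e /(conv (star a))[n0 h]; exists n0 => n /h/(_ 0).
  have := cstar n 0 a; rewrite !iota_id => ->; rewrite -rmorphB cabsJ; apply.
  by rewrite /ldist big1 ?muln0 // => i _; rewrite !ffunE subrr.
exists Q; split; last first.
  by move=> a; rewrite /Qomega (limC (lim a)) conjCK.
split.
- move=> n; rewrite /Q; case: ifPn => [h|_].
    by have [] := HN (J n) n (JN _ h).
  by rewrite -(scale0r (1 : O)); apply: (OX_scale HO); exact: (OX_one HO).
- exists ((M ^+ 2 + 1) * 3 ^+ D); split.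
    by rewrite mulr_gt0 ?exprn_gt0 // ltr_wpDl ?sqr_ge0.
  move=> n n0; rewrite /Qp; have [h|h] := leqP (N 0%N) n; last first.
    rewrite /Q leqNgt h /= omega_0 scale0r subr0 mulr0 omega_0 lecR.
    by rewrite !mulr_ge0 ?addr_ge0 ?sqr_ge0 ?exprn_ge0.
  have [_ + _] := HN (J n) n (JN _ h); rewrite -QE // => h'; apply: le_trans h' _.
  rewrite lecR !ler_wpM2r ?exprn_ge0 // lerD //.
    by rewrite lerXn2r ?nnegrE ?fnorm_ge0.
  by rewrite invf_le1 // ler1n.
- by move=> a; apply: cvgP; exact: lim.
(* This is the range of shifts for which [conv] is uniform. *)
- exists (2 * D.+1)%:R^-1; split.
    by rewrite invr_gt0 ltr0n /= invf_lt1 ?ltr1n ?ltr0n //; lia.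
  move=> a e e0; have e2 : 0 < e / 2 by rewrite divr_gt0.
  have [n0 h] := conv (star a) _ e2; exists n0 => n /h {}h x y xn yn.
  have H (z : Zd D) : (znorm z)%:R <= (2 * D.+1)%:R^-1 * n%:R :> R ->
      (2 * D.+1 * znorm z <= n)%N.
    by rewrite ler_pdivlMl ?ltr0n // -natrM ler_nat.
  rewrite !cstar -rmorphB cabsE cabsJ ltcR.
  have := h _ (H _ yn); have := h _ (H _ xn).
  move: (omega _) (omega _) (G _) => w2 w1 g hx hy.
  rewrite (_ : w1 - w2 = (w1 - g) - (w2 - g)); last by ring.
  by apply: le_lt_trans (cabsB _ _) _; rewrite (splitr e); apply: ltrD.
Qed.

(** * The completion and its pairing with observables *)

Notation H := (Hstar star iota omega).

Lemma class_of_proof u : fcauchy B u -> is_class star iota omega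
  [set v | cauchyS star iota omega v /\ equivS star iota omega u v].
Proof. by move=> hu; exists u. Qed.

Definition class_of u (hu : fcauchy B u) : H := exist _ _ (class_of_proof hu).

Lemma equivS_sym u v : equivS star iota omega u v -> equivS star iota omega v u.
Proof.
move=> h e /h[N hN]; exists N => n /hN.
by rewrite /seminormS -!/(fnorm B _) (fnorm_distC psd_formS).
Qed.

Lemma equivS_trans u v w : equivS star iota omega u v ->
  equivS star iota omega v w -> equivS star iota omega u w.
Proof.
move=> h1 h2 e e0; have e2 : 0 < e / 2 by rewrite divr_gt0.
have [N1 k1] := h1 _ e2; have [N2 k2] := h2 _ e2.
exists (maxn N1 N2) => n; rewrite geq_max => /andP[/k1 l1 /k2 l2].
rewrite -(subrK (v n) (u n)) -addrA (splitr e).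
by apply: le_lt_trans (fnormD psd_formS _ _) _; exact: ltrD.
Qed.

Lemma rep_spec (h : H) : proj1_sig h (rep h).
Proof.
apply: epsilon_spec; have [u [hu E]] := proj2_sig h; exists u; rewrite E.
split=> // e e0; exists 0%N => n _.
rewrite subrr /seminormS -/(fnorm B 0) -(scale0r (0 : O)) (fnormZ psd_formS).
by rewrite cabs0 mul0r.
Qed.

Lemma rep_cauchy (h : H) : fcauchy B (rep h).
Proof. by have := rep_spec h; have [u [hu ->]] := proj2_sig h => -[]. Qed.

Lemma formH_cvg (h : H) a : (fun n => B (rep h n) a) @ \oo --> formH h a.
Proof. by apply: (fcauchy_cvg psd_formS); exact: rep_cauchy. Qed.

(** [formH] is computed on a chosen representative; by Cauchy-Schwarz, equivalent sequences give the
    same limit. *)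
Lemma formH_class_of u (hu : fcauchy B u) a l :
  (fun n => B (u n) a) @ \oo --> (l : R[i]) -> formH (class_of hu) a = l.
Proof.
move=> hl; have [_ eq] := rep_spec (class_of hu).
apply: limC; apply/cvgC_iff => e e0; have e2 : 0 < e / 2 by rewrite divr_gt0.
have s1 : 0 < fnorm B a + 1 by rewrite ltr_wpDl ?fnorm_ge0.
have /eq[N1 h1] : 0 < e / 2 / (fnorm B a + 1) by rewrite divr_gt0.
have /cvgC_iff/(_ _ e2)[N2 h2] := hl.
exists (maxn N1 N2) => n; rewrite geq_max => /andP[/h1 k1 /h2 k2].
rewrite -(subrK (B (u n) a) (B _ a)) -addrA.
apply: le_lt_trans (cabsD _ _) _; rewrite (splitr e); apply: ltrD => //.
rewrite cabs_distC -(psdBl psd_formS).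
apply: le_lt_trans (psd_CS psd_formS _ _) _.
move: k1; rewrite ltr_pdivlMr //; apply: le_lt_trans.
by rewrite ler_wpM2l ?fnorm_ge0 // lerDl.
Qed.

Lemma Hstar_ext (h h' : H) : proj1_sig h = proj1_sig h' -> h = h'.
Proof.
case: h h' => [E hE] [E' hE'] /= e; case: _ / e hE' => hE'.
by congr exist; exact: Prop_irrelevance.
Qed.

(** The difference of the representatives is Cauchy and tends weakly to 0, hence in seminorm by
    [fcauchy_weak0]. *)
Lemma formH_inj (h h' : H) : (forall a, formH h a = formH h' a) -> h = h'.
Proof.
move=> hh.
have eq : equivS star iota omega (rep h) (rep h').
  have ch := fcauchyB psd_formS (rep_cauchy h) (rep_cauchy h').
  apply: (fcauchy_weak0 psd_formS ch) => a.
  rewrite -[X in _ --> X](subrr (formH h a)) {2}hh.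
  under eq_fun do rewrite (psdBl psd_formS).
  by apply: cvgCD; [exact: formH_cvg|apply: cvgN; exact: formH_cvg].
have cl (g : H) : proj1_sig g =
    [set v | cauchyS star iota omega v /\ equivS star iota omega (rep g) v].
  have := rep_spec g; have [u [hu ->]] := proj2_sig g => -[_ hr].
  apply/seteqP; split=> v [cv ev]; split=> //.
    exact: equivS_trans (equivS_sym hr) ev.
  exact: equivS_trans hr ev.
apply: Hstar_ext; rewrite !cl; apply/seteqP; split=> v [cv ev]; split=> //.
  exact: equivS_trans (equivS_sym eq) ev.
exact: equivS_trans eq ev.
Qed.

Lemma charge_formH F : Qstar_set star OX iota omega F ->
  exists h : H, forall a, formH h a = F a.
Proof.
move=> [Q [plQ FQ]].
have FE a : F a = Num.conj (Qomega star omega Q (star a)).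
  by rewrite -FQ (star_invol HO).
have lim a : (fun n => omega (a * Qp omega Q n)) @ \oo --> F a.
  have h := Q_II plQ; rewrite FE; have := cvgCJ (h (star a)).
  under eq_fun do rewrite -omega_star (star_mul HO) !(star_invol HO).
  exact.
have FD a b : F (a + b) = F a + F b.
  apply: (cvgC_unique (lim _)); under eq_fun do rewrite mulrDl (omega_add Hom).
  by apply: cvgCD.
have FZ k a : F (k *: a) = k * F a.
  apply: (cvgC_unique (lim _)); under eq_fun do rewrite -scalerAl (omega_scale Hom).
  by apply: cvgCM.
have [C [C0 FC]] := pseudolocal_bounded plQ.
have [|u [hu hF]] := riesz_seq psd_formS FD FZ C0.
  by move=> a; rewrite FE cabsJ.
by exists (class_of hu) => a; exact: formH_class_of.
Qed.

Lemma formH_charge (h : H) : Qstar_set star OX iota omega (formH h).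
Proof.
have [M [M0 [N hN]]] := fcauchy_bounded psd_formS (rep_cauchy h).
(* The shift by [N] keeps only the terms for which the bound [M] is known. *)
apply: (@charge_of_bounded_sequence (fun n => rep h (n + N)%N) M).
  by move=> j; rewrite hN // leq_addl.
move=> b; have /cvgC_iff hc := @formH_cvg h b; apply/cvgC_iff => e /hc[N0 h0].
by exists N0 => n n0; apply: h0; exact: leq_trans n0 (leq_addr _ _).
Qed.

End QuasiLocalState.

Theorem theorem5p6 (R : realType) (D : nat) (O : algType R[i])
    (star : O -> O) (nrm : O -> R) (OX : {fset Zd D} -> set O)
    (iota : Zd D -> O -> O) (omega : O -> R[i])
    (nu : nat -> R) (f : nat -> R) (p : R)
    (HO : quasi_local star nrm OX iota)
    (Hom : clustering_state star nrm OX iota omega nu f p) :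
  exists Dstar : (O -> R[i]) -> Hstar star iota omega,
    set_bij (Qstar_set star OX iota omega) setT Dstar /\
    forall F, Qstar_set star OX iota omega F ->
      forall a : O, F a = formH (Dstar F) a.
Proof.
have z0 : fcauchy (formS star iota omega) (fun=> 0).
  move=> e e0; exists 0%N => m n _ _.
  by rewrite subrr -(scale0r (0 : O)) (fnormZ (psd_formS HO Hom)) cabs0 mul0r.
(* The zero class only witnesses that the type is inhabited; the value is meaningful when [F] is a
   charge. *)
pose Ds F : Hstar star iota omega :=
  epsilon (inhabits (class_of z0)) (fun h => forall a, formH h a = F a).
have DsE F : Qstar_set star OX iota omega F -> forall a, formH (Ds F) a = F a.
  move=> hF; apply: (epsilon_spec (inhabits (class_of z0))
    (fun h => forall a, formH h a = F a)).
  exact: (charge_formH HO Hom).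
exists Ds; split; last by move=> F hF a; rewrite DsE.
split.
- by [].
- move=> F G /set_mem hF /set_mem hG FG; apply/funext => a.
  by rewrite -DsE // FG DsE.
(* The preimage of [h] is its own functional [formH h], and [formH_inj] identifies the image with
   [h]. *)
- move=> h _; have hq := formH_charge HO Hom h.
  by exists (formH h) => //; apply: (formH_inj HO Hom) => a; rewrite DsE.
Qed.
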